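(* Let $w\in S_n$ with $\ell(w)=n-1$. Then there exists a sequence of positive integers $(i_1,\dots,i_{n-1})$ with $i_j\le j$ for all $j$ such that the integer $T_{i_1}T_{i_2}\cdots T_{i_{n-1}}\mathfrak S_w$ is strictly positive. In particular $\langle\mathfrak S_w\rangle_n>0$.
   Context: $R_if=f(x_1,\dots,x_{i-1},0,x_i,\dots)$, $T_if=\frac1{x_i}(R_{i+1}f-R_if)$, composed right to left. Schubert polynomials $\mathfrak S_w$: $\mathfrak S_{\mathrm{id}}=1$, $\partial_i\mathfrak S_w=\mathfrak S_{ws_i}$ if $w(i)>w(i+1)$ and $0$ otherwise, homogeneous of degree $\ell(w)$, and $\mathfrak S_w\in\mathbb Z[x_1,\dots,x_n]$ for $w\in S_n$. Divided symmetrization: $\langle f\rangle_n=\sum_{\sigma\in S_n}\frac{f(x_{\sigma(1)},\dots,x_{\sigma(n)})}{(x_{\sigma(1)}-x_{\sigma(2)})\cdots(x_{\sigma(n-1)}-x_{\sigma(n)})}$. *)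

(* Defs.v *)
From HB Require Import structures.
From mathcomp Require Import all_boot all_order all_algebra all_fingroup.
From mathcomp Require Import fraction.
From mathcomp Require Import mpoly.
From Stdlib Require Import ClassicalEpsilon.

Set Implicit Arguments.
Unset Strict Implicit.
Unset Printing Implicit Defensive.

Import Order.TTheory GRing.Theory Num.Theory.
Local Open Scope ring_scope.

(* Throughout, we work with permutations in S_{n+1} (= 'S_n.+1) and
   polynomials in Z[x_1, ..., x_{n+1}] = {mpoly int[n.+1]}; the variable
   x_j (1-based, as in the paper) is 'X_(j-1) (0-based). *)

Notation "x %:F" := (@FracField.tofrac _ x) : ring_scope.

Section Defs.
Variable n : nat.
Local Notation P := {mpoly int[n.+1]}.

(* Exact division in the integral domain P: the quotient q with d * q = p
   (chosen by Hilbert's epsilon; it is unique when d <> 0 and it exists). *)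
Definition exact_div (p d : P) : P :=
  epsilon (inhabits 0) (fun q : P => p = d * q).

Definition xvar (j : nat) : P := 'X_(inord j.-1).

(* R_i f = f(x_1, ..., x_{i-1}, 0, x_i, x_{i+1}, ...) : the j-th argument
   (1-based) becomes x_j if j < i, 0 if j = i, and x_{j-1} if j > i. *)
Definition Rop (i : nat) (f : P) : P :=
  f \mPo [tuple (if (j.+1 < i)%N then xvar j.+1
                 else if j.+1 == i then 0 else xvar j) | j < n.+1].

Definition Top (i : nat) (f : P) : P :=
  exact_div (Rop i.+1 f - Rop i f) (xvar i).

(* the simple transposition s_i = (i, i+1) acting on variables, for
   i : 'I_n (0-based), i.e. swapping positions i+1 and i+2 (1-based) *)
Definition sfirst (i : 'I_n) : 'I_n.+1 := widen_ord (leqnSn n) i.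
Definition ssecond (i : 'I_n) : 'I_n.+1 := lift ord0 i.

Definition permvars (s : 'S_n.+1) (f : P) : P :=
  f \mPo [tuple 'X_(s j) | j < n.+1].

Definition ddiff (i : 'I_n) (f : P) : P :=
  exact_div (f - permvars (tperm (sfirst i) (ssecond i)) f)
            ('X_(sfirst i) - 'X_(ssecond i)).

Definition len (w : 'S_n.+1) : nat :=
  #|[set p : 'I_n.+1 * 'I_n.+1 | (p.1 < p.2)%N && (w p.2 < w p.1)%N]|.

(* staircase monomial x_1^n x_2^(n-1) ... x_{n+1}^0 = Schubert polynomial
   of the longest element w_0 *)
Definition staircase : P := \prod_(j < n.+1) 'X_j ^+ (n - j).

(* the product w s_i as functions (first s_i, then w); in MathComp
   (s * t) x = t (s x) *)
Definition mul_s (w : 'S_n.+1) (i : 'I_n) : 'S_n.+1 :=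
  (tperm (sfirst i) (ssecond i) * w)%g.

(* Lascoux--Schuetzenberger: S_{w_0} = x^delta, and
   S_w = d_i S_{w s_i} whenever w(i) < w(i+1) (we use the first ascent).
   The fuel k = l(w_0) - l(w) is exactly the number of steps needed. *)
Fixpoint schub_aux (k : nat) (w : 'S_n.+1) : P :=
  match k with
  | 0%N => staircase
  | k'.+1 =>
      match [pick i : 'I_n | (w (sfirst i) < w (ssecond i))%N] with
      | Some i => ddiff i (schub_aux k' (mul_s w i))
      | None => staircase
      end
  end.

Definition schubert (w : 'S_n.+1) : P :=
  schub_aux ('C(n.+1, 2) - len w) w.

Definition divsym (f : P) : {fraction P} :=
  \sum_(s : 'S_n.+1)
     (permvars s f)%:F /
     (\prod_(k < n) ('X_(s (sfirst k)) - 'X_(s (ssecond k)) : P))%:F.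

End Defs.

(* Main.v *)
Require Import Defs.
From HB Require Import structures.
From mathcomp Require Import all_boot all_order all_algebra all_fingroup.
From mathcomp Require Import fraction.
From mathcomp Require Import mpoly.
From mathcomp Require Import ring zify.
From Stdlib Require Import ClassicalEpsilon.

Set Implicit Arguments.
Unset Strict Implicit.
Unset Printing Implicit Defensive.

Import Order.TTheory GRing.Theory Num.Theory.
Local Open Scope ring_scope.

(* The trimmings satisfy the twisted Leibniz rule
   T_j(fg) = T_j(f) R_(j+1)(g) + R_j(f) T_j(g).  Put D_0 = id and
   D_(m+1) = D_m (T_1 + .. + T_(m+1)), so that D_n f is the sum of
   T_(i_1) .. T_(i_n) f over all sequences with i_j <= j.  It therefore suffices
   that D_n S_w > 0 and that D_n f is the divided symmetrization of f, for f of
   degree n in n+1 variables: some term of a positive sum is positive.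

   With u_i = x_1 + .. + x_i, the functional D_n kills u_(n+1) h and the Klyachko
   elements u_i (x_i - x_(i+1)) h.  Modulo these, sum_i u_i d_i is a derivation
   that fixes the variables, so it multiplies f by its degree.  As d_i S_w is
   S_(w s_i) or 0, iterating gives: l(w)! D_n S_w is the sum of
   D_n (u_(a_1) .. u_(a_n)) over the reduced words a of w, and each of these terms
   is positive by induction on n with the Leibniz rule.

   For the divided symmetrization, summing over the position of the last
   variable turns the n+1-variable symmetrization of f into the n-variable one of
   the sum of the d_i f with the last variable moved next to slot i, which differs from
   T_1 f + .. + T_n f by multiples of spectator variables, killed by D_(n-1). *)

HB.instance Definition _ (n i : nat) :=
  GRing.RMorphism.copy (@Rop n i) (comp_mpoly [tuple (if (j.+1 < i)%N then xvar n j.+1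
                 else if j.+1 == i then 0 else xvar n j) | j < n.+1]).
HB.instance Definition _ (n : nat) (s : 'S_n.+1) :=
  GRing.RMorphism.copy (permvars s) (comp_mpoly [tuple 'X_(s j) | j < n.+1]).

(** * Homogeneous polynomials and twisted derivations *)

Section Homogeneous.
Variable n : nat.
Local Notation P := {mpoly int[n.+1]}.

(** A homogeneous polynomial is a combination of monomials, each built one variable at a time. The
    degree is an argument of [K] so that degree-dependent claims fit. *)
Lemma homog_ind (K : nat -> P -> Prop) :
    (forall d, K d 0) ->
    (forall d f g, K d f -> K d g -> K d (f + g)) ->
    (forall d c f, K d f -> K d (c *: f)) ->
    K 0%N 1 ->
    (forall d j f, f \is d.-homog -> K d f -> K d.+1 ('X_j * f)) ->
  forall d f, f \is d.-homog -> K d f.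
Proof.
move=> K0 KD KZ K1 KX d f /dhomogP hf.
have KM e (m : 'X_{1..n.+1}) : mdeg m = e -> K e 'X_[m].
  elim: e m => [|e IH] m dm.
    by move/eqP: dm; rewrite mdeg_eq0 => /eqP->; rewrite mpolyX0.
  have [j mj] : exists j, (0 < m j)%N.
    apply/existsP; apply: contraPT dm; rewrite negb_exists => /forallP m0.
    suff -> : m = 0%MM by rewrite mdeg0.
    by apply/mnmP => j; rewrite mnm0E; apply/eqP; rewrite -leqn0 leqNgt.
  have mE : m = (U_(j) + (m - U_(j)))%MM.
    by rewrite addmC submK // lep1mP -lt0n.
  have de : mdeg (m - U_(j)) = e by move: dm; rewrite {1}mE mdegD mdeg1 add1n => -[].
  by rewrite mE mpolyXD; apply: KX; [rewrite dhomogX; apply/eqP|apply: IH].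
rewrite (mpolyE f) big_seq; elim/big_ind: _ => [|*|m /hf] //; first exact: KD.
by move=> dm; apply: KZ; apply: KM.
Qed.

Lemma homogX j : ('X_j : P) \is 1.-homog.
Proof. by rewrite dhomogX; apply/eqP/mdeg1. Qed.

Lemma homog0C (f : P) : f \is 0.-homog -> f = (f@_0%MM)%:MP.
Proof.
move=> /dhomogP hf; apply/mpolyP => m; rewrite mcoeffC eq_sym.
case: eqP => [->|/eqP m0]; first by rewrite mulr1.
rewrite mulr0; apply: memN_msupp_eq0; apply: contra m0 => /hf dm.
by rewrite eq_sym -mdeg_eq0; apply/eqP.
Qed.

(** The degree [e.+1] part of [x * q] is [x] times the degree [e] part of [q], and there are no zero
    divisors. *)
Lemma homog_factor (x q : P) d : x \is 1.-homog -> x != 0 ->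
  x * q \is d.+1.-homog -> q \is d.-homog.
Proof.
move=> hx x0 hxq.
have key e : e != d -> pihomog mdeg e q = 0.
  move=> ed; have : pihomog mdeg e.+1 (x * q) = x * pihomog mdeg e q.
    rewrite {1}(pihomog_partitionE (leqnn (mmeasure mdeg q))) mulr_sumr raddf_sum /=.
    have h i : pihomog mdeg e.+1 (x * pihomog mdeg i q) =
               if i == e then x * pihomog mdeg e q else 0.
      have hi := dhomogM hx (pihomogP mdeg i q).
      case: eqP => [<-|/eqP ie]; first by rewrite pihomog_dE.
      by rewrite (pihomog_ne0 _ hi).
    have [le|gt] := ltnP e (mmeasure mdeg q).
      rewrite (bigD1 (Ordinal le)) //= big1 ?addr0 => [|i]; rewrite h ?eqxx //.
      by rewrite -val_eqE /= => /negbTE->.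
    rewrite big1 => [|i _]; last first.
      by rewrite h ltn_eqF // (leq_trans (ltn_ord i)).
    have -> : pihomog mdeg e q = 0; last by rewrite mulr0.
    rewrite pihomogE big_seq_cond big1 // => m /andP[mq /eqP dm].
    have := mmeasure_mnm_lt mdeg mq; rewrite dm => /leq_trans/(_ gt).
    by rewrite ltnn.
  rewrite (@pihomog_ne0 _ _ _ d.+1) // 1?eq_sym // => /esym/eqP.
  by rewrite mulf_eq0 (negbTE x0) => /eqP.
rewrite (pihomog_partitionE (leqnn (mmeasure mdeg q))).
apply: rpred_sum => i _; have [->|/key->] := eqVneq (i : nat) d.
  exact: pihomogP.
exact: dhomog0.
Qed.

Lemma homog_rmorph (phi : {rmorphism P -> P}) d f :
  (forall j, phi 'X_j \is 1.-homog) -> f \is d.-homog -> phi f \is d.-homog.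
Proof.
move=> hphi; move: d f; apply: homog_ind => [d|d f g hf hg|d c f hf||d j f _ hf].
- by rewrite rmorph0 dhomog0.
- by rewrite rmorphD; apply: dhomogD.
(* An integer constant is a multiple of 1, so every ring morphism fixes it. *)
- rewrite -mul_mpolyC rmorphM -[c]intz rmorph_int rmorph_int.
  by rewrite -(rmorph_int (@mpolyC n.+1 int)) mul_mpolyC; apply: dhomogZ.
- by rewrite rmorph1 dhomog1.
- by rewrite rmorphM; apply: (dhomogM (hphi j) hf).
Qed.

Lemma rmorph_mpoly_ext (S : comNzRingType) (phi psi : {rmorphism P -> S}) :
  (forall j, phi 'X_j = psi 'X_j) -> phi =1 psi.
Proof.
move=> e f; rewrite (mpolyE f) !rmorph_sum; apply: eq_bigr => m _.
rewrite -!mul_mpolyC !rmorphM -[f@_m]intz !rmorph_int mpolyXE_id !rmorph_prod.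
by congr (_ * _); apply: eq_bigr => j _; rewrite !rmorphXn e.
Qed.

End Homogeneous.

Section TwistedDerivation.
Variables (n : nat).
Local Notation P := {mpoly int[n.+1]}.
Variables (phi psi : {rmorphism P -> P}) (x : P).
Hypothesis x0 : x != 0.
Hypothesis xX : forall j, exists c : P, phi 'X_j - psi 'X_j = x * c.

(** Common form of both families of operators: trimmings take [R_(j+1)], [R_j] and [x_j] for [phi],
    [psi] and [x]; divided differences take the identity, [s_i] and [x_i - x_(i+1)]. *)
Definition tder (f : P) : P := exact_div (phi f - psi f) x.

(** The [f] for which [x] divides [phi f - psi f] include the integers and the variables and are
    closed under sums and products, so the epsilon in [exact_div] has a witness. *)
Lemma tderE f : x * tder f = phi f - psi f.
Proof.
have H : exists q : P, phi f - psi f = x * q; last first.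
  by rewrite -(epsilon_spec (inhabits 0) (fun q : P => phi f - psi f = x * q) H).
rewrite (mpolyE f); elim/big_ind: _ => [|g h [q e] [r e']|m _].
- by exists 0; rewrite !rmorph0 mulr0 subrr.
- by exists (q + r); rewrite !rmorphD mulrDr -e -e'; ring.
have [q e] : exists q : P, phi 'X_[m] - psi 'X_[m] = x * q; last first.
  exists (f@_m *: q); rewrite -!mul_mpolyC !rmorphM -[f@_m]intz !rmorph_int.
  by rewrite mulrCA -e mulrBr.
have cl (f1 f2 : P) : (exists q : P, phi f1 - psi f1 = x * q) ->
    (exists q : P, phi f2 - psi f2 = x * q) ->
    exists q : P, phi (f1 * f2) - psi (f1 * f2) = x * q.
  move=> [q e] [r e']; exists (q * phi f2 + psi f1 * r).
  by rewrite !rmorphM mulrDr mulrA -e mulrCA -e'; ring.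
rewrite mpolyXE_id; elim/big_ind: _ => [||j _]; last 1 first.
- elim: (m j) => [|k IH]; first by exists 0; rewrite expr0 !rmorph1 mulr0 subrr.
  by rewrite exprS; apply: cl.
- by exists 0; rewrite !rmorph1 mulr0 subrr.
- exact: cl.
Qed.

Lemma tder_eq f q : x * q = phi f - psi f -> tder f = q.
Proof. by rewrite -tderE => /(mulfI x0)->. Qed.

Lemma tderB f g : tder (f - g) = tder f - tder g.
Proof. by apply: tder_eq; rewrite mulrBr !tderE !rmorphB; ring. Qed.

Lemma tderM f g : tder (f * g) = tder f * phi g + psi f * tder g.
Proof.
by apply: tder_eq; rewrite mulrDr mulrA tderE mulrCA tderE !rmorphM; ring.
Qed.

Lemma tderC c : tder c%:MP = 0.
Proof. by apply: tder_eq; rewrite -[c]intz !rmorph_int subrr mulr0. Qed.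

Lemma tder_homog d f : x \is 1.-homog -> (forall j, phi 'X_j \is 1.-homog) ->
  (forall j, psi 'X_j \is 1.-homog) -> f \is d.+1.-homog -> tder f \is d.-homog.
Proof.
move=> hx hphi hpsi hf; apply: (homog_factor hx x0).
by rewrite tderE; apply: rpredB; apply: homog_rmorph.
Qed.

End TwistedDerivation.

(** * Trimming operators *)

Section Trimming.
Variable n : nat.
Local Notation P := {mpoly int[n.+1]}.
Local Notation x := (xvar n).
Local Notation R := (@Rop n).
Local Notation T := (@Top n).

Lemma xvarE (j : 'I_n.+1) : 'X_j = x j.+1.
Proof. by rewrite /xvar /= inord_val. Qed.

Lemma xvar_neq0 j : x j != 0.
Proof.
by apply/eqP => /mpolyP/(_ U_(inord j.-1)%MM); rewrite mcoeffX eqxx mcoeff0.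
Qed.

Lemma Rop_xvar i j : (0 < j <= n.+1)%N ->
  R i (x j) = if (j < i)%N then x j else if j == i then 0 else x j.-1.
Proof.
case: j => // j jn; rewrite /Rop /xvar comp_mpolyXU -tnth_nth tnth_mktuple.
by rewrite /= inordK.
Qed.

Lemma Rop_X i (j : 'I_n.+1) :
  R i 'X_j = if (j.+1 < i)%N then x j.+1 else if j.+1 == i then 0 else x j.
Proof. by rewrite xvarE Rop_xvar //= ltn_ord. Qed.

Lemma RopM i f g : R i (f * g) = R i f * R i g.
Proof. exact: rmorphM. Qed.

Lemma RopB i f g : R i (f - g) = R i f - R i g.
Proof. exact: rmorphB. Qed.

Lemma Rop_homog i d f : (0 < i)%N -> f \is d.-homog -> R i f \is d.-homog.
Proof.
move=> i0; apply: (@homog_rmorph n (R i)) => j.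
rewrite /= Rop_X.
by case: ifP => _; [apply: homogX | case: eqP => _; [apply: dhomog0 | apply: homogX]].
Qed.

(** [R_(j+1)] and [R_j] differ only on [x_j], sent to [x_j] and 0, and on [x_(j+1)], sent to 0 and
    [x_j]. *)
Lemma Top_divides j (k : 'I_n.+1) : (0 < j <= n)%N ->
  exists c : P, R j.+1 'X_k - R j 'X_k = x j * c.
Proof.
move=> jn; rewrite !Rop_X.
have [kj|kj|<-] := ltngtP k.+1 j.
- by exists 0; rewrite ltnW // subrr mulr0.
- rewrite ltnNge kj /= eqSS; case: eqP => [->|_].
    by exists (-1); rewrite sub0r mulrN1.
  by exists 0; rewrite subrr mulr0.
- by exists 1; rewrite ltnSn mulr1 subr0.
Qed.

Section Fixed.
Variable j : nat.
Hypothesis jn : (0 < j <= n)%N.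
Let D := fun k => Top_divides k jn.

Lemma TopE f : x j * T j f = R j.+1 f - R j f.
Proof. exact: (tderE D). Qed.

Lemma Top_eq f q : x j * q = R j.+1 f - R j f -> T j f = q.
Proof. exact: (tder_eq (xvar_neq0 j) D). Qed.

Lemma TopB f g : T j (f - g) = T j f - T j g.
Proof. exact: (tderB (xvar_neq0 j) D). Qed.

Lemma Top0 : T j 0 = 0.
Proof. by have := TopB 0 0; rewrite !subrr. Qed.

Lemma TopD f g : T j (f + g) = T j f + T j g.
Proof. by rewrite -[g]opprK TopB -[- - g]sub0r -[- g]sub0r !TopB Top0; ring. Qed.

Lemma TopM f g : T j (f * g) = T j f * R j.+1 g + R j f * T j g.
Proof. exact: (tderM (xvar_neq0 j) D). Qed.

Lemma TopC c : T j c%:MP = 0.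
Proof. exact: (tderC (xvar_neq0 j) D). Qed.

Lemma Top_homog d f : f \is d.+1.-homog -> T j f \is d.-homog.
Proof.
apply: (tder_homog (xvar_neq0 j) D) => [|k|k]; first exact: homogX.
  by apply: Rop_homog => //; apply: homogX.
by apply: Rop_homog; [case/andP: jn|apply: homogX].
Qed.

Lemma Top_xvar k : (0 < k <= n.+1)%N -> T j (x k) = (k == j)%:R - (k == j.+1)%:R.
Proof.
move=> kn; apply: Top_eq; rewrite !Rop_xvar //.
have [kj|kj|->] := ltngtP k j.
- by rewrite ltnS (ltnW kj) (ltn_eqF (ltnW _)) // subrr mulr0 subrr.
- rewrite ltnNge kj /=; case: eqP => [->|_]; last by rewrite !subrr mulr0.
  by rewrite !sub0r mulrN1.
- by rewrite ltnSn (ltn_eqF (ltnSn j)) subr0 mulr1 subr0.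
Qed.

End Fixed.

Definition u i : P := \sum_(k < i) x k.+1.

Lemma u0 : u 0 = 0.
Proof. by rewrite /u big_ord0. Qed.

Lemma uS i : u i.+1 = u i + x i.+1.
Proof. by rewrite /u big_ord_recr. Qed.

Lemma u_homog i : u i \is 1.-homog.
Proof. by apply: rpred_sum => k _; apply: homogX. Qed.

Definition shift k i : nat := if (k <= i)%N then i.-1 else i.

(** If [k <= i], one summand becomes 0 and the later ones slide down, which leaves the first [i - 1]
    variables. *)
Lemma Rop_u k i : (0 < k)%N -> (i <= n.+1)%N -> R k (u i) = u (shift k i).
Proof.
move=> k0; elim: i => [|i IH] i_n.
  by rewrite u0 rmorph0 /shift; case: ifP => _; rewrite u0.
rewrite uS rmorphD /= IH 1?ltnW // Rop_xvar // /shift.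
have [ki|ki|<-] := ltngtP i.+1 k.
- by rewrite leqNgt ltnW //= -uS.
- case: i ki {IH i_n} => [|i] ki; first by case: k k0 ki.
  by rewrite -ltnS ki /= -uS.
- by rewrite ltnn /= addr0.
Qed.

(** The values 1 at [x_j] and -1 at [x_(j+1)] telescope. The partial sums are thus dual to the
    trimmings, which makes Leibniz expansions of their products positive. *)
Lemma Top_u j i : (0 < j <= n)%N -> (i <= n.+1)%N -> T j (u i) = (i == j)%:R.
Proof.
move=> jn; elim: i => [|i IH] i_n.
  by rewrite u0 Top0 //; case: j jn.
rewrite uS TopD // IH 1?ltnW // Top_xvar // eqSS.
by have [->|_] := eqVneq i j; rewrite ?(gtn_eqF (ltnSn j)) ?subr0 /=; ring.
Qed.

End Trimming.

(** * Divided differences *)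

Section DividedDifferences.
Variable n : nat.
Local Notation P := {mpoly int[n.+1]}.
Implicit Types (i j : 'I_n) (f g : P).

Definition simple i : 'S_n.+1 := tperm (sfirst i) (ssecond i).
Definition alpha i : P := 'X_(sfirst i) - 'X_(ssecond i).

Lemma sfirst_ssecond i : sfirst i != ssecond i.
Proof. by rewrite -val_eqE /= ltn_eqF. Qed.

Lemma mpolyXI (k l : 'I_n.+1) : ('X_k : P) = 'X_l -> k = l.
Proof.
move/(congr1 (fun p : P => p@_U_(k))); rewrite !mcoeffX eqxx.
case: eqP => // /(congr1 (fun m : 'X_{1.. n.+1} => m k)).
by rewrite !mnm1E eqxx; case: eqP.
Qed.

Lemma alpha_neq0 i : alpha i != 0.
Proof.
by rewrite subr_eq0; apply/eqP => /mpolyXI/eqP; rewrite (negbTE (sfirst_ssecond i)).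
Qed.

Lemma permvarsX (s : 'S_n.+1) k : permvars s ('X_k : P) = 'X_(s k).
Proof. by rewrite /permvars comp_mpolyXU -tnth_nth tnth_mktuple. Qed.

Lemma permvars_comp (s t : 'S_n.+1) f :
  permvars s (permvars t f) = permvars (t * s)%g f.
Proof.
apply: (@rmorph_mpoly_ext n _ (permvars s \o permvars t) (permvars (t * s)%g)) => j /=.
by rewrite !permvarsX permM.
Qed.

Lemma permvars1 f : permvars 1 f = f.
Proof.
apply: (@rmorph_mpoly_ext n _ (permvars 1) idfun) => j /=.
by rewrite permvarsX perm1.
Qed.

Lemma ddiff_divides i (k : 'I_n.+1) :
  exists c : P, 'X_k - permvars (simple i) 'X_k = alpha i * c.
Proof.
rewrite permvarsX; case: tpermP => [->|->|_ _].
- by exists 1; rewrite mulr1.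
- by exists (-1); rewrite mulrN1 opprB.
- by exists 0; rewrite subrr mulr0.
Qed.

Section Fixed.
Variable i : 'I_n.
Let D := ddiff_divides i.
Local Notation s := (permvars (simple i)).

Lemma ddiffE f : alpha i * ddiff i f = f - s f.
Proof. exact: (@tderE n idfun s _ D). Qed.

Lemma ddiff_eq f q : alpha i * q = f - s f -> ddiff i f = q.
Proof. exact: (@tder_eq n idfun s _ (alpha_neq0 i) D). Qed.

Lemma ddiffM f g : ddiff i (f * g) = ddiff i f * g + s f * ddiff i g.
Proof. exact: (@tderM n idfun s _ (alpha_neq0 i) D). Qed.

Lemma ddiffC c : ddiff i c%:MP = 0.
Proof. exact: (@tderC n idfun s _ (alpha_neq0 i) D). Qed.

Lemma alpha_homog : alpha i \is 1.-homog.
Proof. by apply: rpredB; apply: homogX. Qed.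

Lemma ddiff_homog d f : f \is d.+1.-homog -> ddiff i f \is d.-homog.
Proof.
apply: (@tder_homog n idfun s _ (alpha_neq0 i) D) => [|k|k] /=.
- exact: alpha_homog.
- exact: homogX.
- by rewrite permvarsX; apply: homogX.
Qed.

Lemma permvars_alpha : s (alpha i) = - alpha i.
Proof. by rewrite rmorphB /= !permvarsX tpermL tpermR opprB. Qed.

Lemma permvars_simpleK f : s (s f) = f.
Proof. by rewrite permvars_comp tperm2 permvars1. Qed.

(** Both [f - s f] and [alpha i] change sign under [s]. *)
Lemma permvars_ddiff f : s (ddiff i f) = ddiff i f.
Proof.
apply: (mulfI (alpha_neq0 i)); rewrite ddiffE.
have := congr1 s (ddiffE f); rewrite rmorphM /= permvars_alpha rmorphB /= permvars_simpleK.
by rewrite mulNr => /(congr1 -%R); rewrite opprK opprB.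
Qed.

Lemma ddiff_ddiff f : ddiff i (ddiff i f) = 0.
Proof. by apply: ddiff_eq; rewrite permvars_ddiff subrr mulr0. Qed.

Lemma ddiff_sym f : s f = f -> ddiff i f = 0.
Proof. by move=> e; apply: ddiff_eq; rewrite e subrr mulr0. Qed.

End Fixed.
End DividedDifferences.

(** * Iterated trimming and Klyachko relations *)

Section IteratedTrimming.
Variable n : nat.
Local Notation P := {mpoly int[n.+1]}.
Local Notation x := (xvar n).
Local Notation u := (@u n).
Local Notation R := (@Rop n).
Local Notation T := (@Top n).

Definition trim_sum m (f : P) : P := \sum_(j < m) T j.+1 f.

Fixpoint trim_iter m (f : P) : P :=
  if m is m'.+1 then trim_iter m' (trim_sum m f) else f.

Local Notation D := trim_iter.

Lemma trim_bound m (j : 'I_m) : (m <= n)%N -> (0 < j.+1 <= n)%N.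
Proof. exact: leq_trans. Qed.

Section Fixed.
Variable m : nat.
Hypothesis mn : (m <= n)%N.

Lemma trim_sumB f g : trim_sum m (f - g) = trim_sum m f - trim_sum m g.
Proof.
by rewrite -sumrB; apply: eq_bigr => j _; rewrite TopB // trim_bound.
Qed.

Lemma trim_sumC c : trim_sum m c%:MP = 0.
Proof. by apply: big1 => j _; rewrite TopC // trim_bound. Qed.

Lemma trim_sum_homog d f : f \is d.+1.-homog -> trim_sum m f \is d.-homog.
Proof.
by move=> hf; apply: rpred_sum => j _; apply: Top_homog; rewrite ?trim_bound.
Qed.

(** For [j <= m], [T_j] kills [u_(m+1)] and [R_j] lowers it to [u_m]; Leibniz does the rest. *)
Lemma trim_sum_u f : trim_sum m (u m.+1 * f) = u m * trim_sum m f.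
Proof.
rewrite mulr_sumr; apply: eq_bigr => j _.
rewrite TopM ?trim_bound // Top_u ?trim_bound // Rop_u // /shift.
by rewrite eqSS gtn_eqF // mul0r add0r leqW.
Qed.

(** A variable beyond [x_(m+1)] is a spectator: [T_1, .., T_m] kill it, and [R_1, .., R_m] only
    shift its index. *)
Lemma trim_sum_xvar k f : (m.+1 < k <= n.+1)%N ->
  trim_sum m (x k * f) = x k.-1 * trim_sum m f.
Proof.
case/andP=> mk kn; have k0 : (0 < k)%N by case: k mk {kn}.
rewrite mulr_sumr; apply: eq_bigr => -[j jm] _.
have jk : (j.+2 < k)%N by apply: leq_ltn_trans mk.
have jn : (0 < j.+1 <= n)%N := leq_trans jm mn.
have [k1 k2 k3] : [/\ (k == j.+1) = false, (k == j.+2) = false & (k < j.+1)%N = false].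
  by split; lia.
by rewrite TopM // Top_xvar ?Rop_xvar ?k0 // k1 k2 k3 subrr mul0r add0r.
Qed.

End Fixed.

Lemma trim_iterB m f g : (m <= n)%N -> D m (f - g) = D m f - D m g.
Proof.
by elim: m f g => //= m IH f g mn; rewrite trim_sumB // IH // ltnW.
Qed.

Lemma trim_iter0 m : (m <= n)%N -> D m 0 = 0.
Proof. by move=> mn; have := trim_iterB 0 0 mn; rewrite !subrr. Qed.

Lemma trim_iterD m f g : (m <= n)%N -> D m (f + g) = D m f + D m g.
Proof.
move=> mn; have eN : D m (- g) = - D m g.
  by rewrite -sub0r trim_iterB // trim_iter0 // sub0r.
by rewrite -{1}[g]opprK trim_iterB // eN opprK.
Qed.

Lemma trim_iter_sum (I : Type) (r : seq I) (Q : pred I) (F : I -> P) m :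
  (m <= n)%N -> D m (\sum_(i <- r | Q i) F i) = \sum_(i <- r | Q i) D m (F i).
Proof.
move=> mn; apply: (big_morph (D m)) => [f g|]; first exact: trim_iterD.
exact: trim_iter0.
Qed.

Lemma trim_iter_low m d f : (m <= n)%N -> (d < m)%N -> f \is d.-homog -> D m f = 0.
Proof.
elim: m d f => // m IH [|d] f mn dm hf /=.
  by rewrite (homog0C hf) trim_sumC // trim_iter0 // ltnW.
by apply: (IH d _ (ltnW mn)) => //; apply: trim_sum_homog.
Qed.

Lemma trim_iter_u m f : (m <= n)%N -> D m (u m.+1 * f) = u 1 * D m f.
Proof.
by elim: m f => //= m IH f mn; rewrite trim_sum_u // IH // ltnW.
Qed.

Lemma trim_iter_xvar m k f : (m <= n)%N -> (m.+1 < k <= n.+1)%N ->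
  D m (x k * f) = x (k - m) * D m f.
Proof.
elim: m k f => [|m IH] k f mn /= kn; first by rewrite subn0.
rewrite trim_sum_xvar // IH; first by rewrite -subn1 -subnDA.
  exact: ltnW.
by lia.
Qed.

(** The factor [u_(m+1)] comes out as [u_1], and [m] trimmings annihilate the cofactor of degree
    below [m]. *)
Lemma trim_iter_u0 m d f : (m <= n)%N -> (d < m)%N -> f \is d.-homog ->
  D m (u m.+1 * f) = 0.
Proof.
by move=> mn dm hf; rewrite trim_iter_u // (trim_iter_low _ dm) ?mulr0.
Qed.

Lemma trim_iter_xvar0 m d k f : (m <= n)%N -> (d < m)%N -> f \is d.-homog ->
  (m.+1 < k <= n.+1)%N -> D m (x k * f) = 0.
Proof.
by move=> mn dm hf kn; rewrite trim_iter_xvar // (trim_iter_low _ dm) ?mulr0.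
Qed.

(** For [i > 0], [x_i - x_(i+1) = 2 u_i - u_(i-1) - u_(i+1)], so this is Klyachko's quadratic
    relation among the partial sums. At [i = 0] it is 0 because [u 0 = 0]. *)
Definition klyachko i : P := u i * (x i - x i.+1).
Local Notation E := klyachko.

(** By Leibniz, the result is again a Klyachko multiple up to corrections at [j = i - 1, i, i + 1].
    Their form is chosen so that they cancel when summed over [j]. *)
Lemma Top_klyachko i j f : (0 < i <= n)%N -> (0 < j <= n)%N ->
  T j (E i * f) =
    (if (i < j)%N then E i * T j f else if (j < i)%N then E i.-1 * T j f else 0)
    + (u i.-1 * R i f + u i * R i.+1 f) *+ (j == i)
    - (u i * R i.+1 f) *+ (j == i.+1) - (u i.-1 * R i f) *+ (j.+1 == i).
Proof.
case: i => // i i_n jn; rewrite /E /=.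
(* Once [R j.+1 f] is eliminated, each case is a polynomial identity in independent quantities. *)
have e : R j.+1 f = R j f + x j * T j f by rewrite TopE // addrC subrK.
have [i1 i2] : (0 < i.+1 <= n.+1)%N /\ (0 < i.+2 <= n.+1)%N by lia.
have j0 : (0 < j)%N by case/andP: jn.
have i3 : (i.+1 <= n.+1)%N by apply: leqW.
rewrite !TopM // TopB // Top_u // !Top_xvar // !RopM !RopB.
rewrite !Rop_xvar // !Rop_u // /shift uS /=.
rewrite (eq_sym j i.+1) (eq_sym j i.+2) (eq_sym j.+1 i.+1) !eqSS !ltnS.
(* The index is now [i.+1], so the exceptional values of [j] are [i], [i.+1] and [i.+2]. *)
have [ji|ij] : (j < i)%N \/ (i <= j)%N by lia.
  have [-> -> -> ->] :
      [/\ (i < j)%N = false, (i == j) = false, (i.+1 < j)%N = false & (i.+1 == j) = false]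
    by split; lia.
  have [-> -> -> ->] :
      [/\ (i.+2 < j)%N = false, (i.+2 == j) = false, (j <= i)%N = true & (j <= i.+1)%N = true]
    by split; lia.
  rewrite !mulr0n; move: (R _ f) (T j f) (x i) (x i.+1) (u i) => *; ring.
have [ej|nj] : j = i \/ (i < j)%N by lia.
  have [-> -> -> ->] :
      [/\ (i < j)%N = false, (i == j) = true, (i.+1 < j)%N = false & (i.+1 == j) = false]
    by split; lia.
  have [-> -> -> ->] :
      [/\ (i.+2 < j)%N = false, (i.+2 == j) = false, (j <= i)%N = true & (j <= i.+1)%N = true]
    by split; lia.
  rewrite ej in e *; rewrite e !mulr0n !mulr1n.
  move: (R _ f) (T i f) (x i) (x i.+1) (u i) => *; ring.
have [ej|nj1] : j = i.+1 \/ (i.+1 < j)%N by lia.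
  have [-> -> -> ->] :
      [/\ (i < j)%N = true, (i == j) = false, (i.+1 < j)%N = false & (i.+1 == j) = true]
    by split; lia.
  have [-> -> -> ->] :
      [/\ (i.+2 < j)%N = false, (i.+2 == j) = false, (j <= i)%N = false & (j <= i.+1)%N = true]
    by split; lia.
  rewrite ej in e *; rewrite e !mulr0n !mulr1n.
  move: (R _ f) (T _ f) (x i.+1) (u i) => *; ring.
have [ej|nj2] : j = i.+2 \/ (i.+2 < j)%N by lia.
  have [-> -> -> ->] :
      [/\ (i < j)%N = true, (i == j) = false, (i.+1 < j)%N = true & (i.+1 == j) = false]
    by split; lia.
  have [-> -> ->] :
      [/\ (i.+2 < j)%N = false, (i.+2 == j) = true & (j <= i.+1)%N = false]
    by split; lia.
  rewrite ej in e *; rewrite uS e !mulr0n !mulr1n.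
  move: (R _ f) (T _ f) (x i.+1) (x i.+2) (u i) => *; ring.
have [-> -> -> ->] :
    [/\ (i < j)%N = true, (i == j) = false, (i.+1 < j)%N = true & (i.+1 == j) = false]
  by split; lia.
have [-> -> ->] :
    [/\ (i.+2 < j)%N = true, (i.+2 == j) = false & (j <= i.+1)%N = false]
  by split; lia.
rewrite uS !mulr0n; move: (R _ f) (T _ f) (x i.+1) (x i.+2) (u i) => *; ring.
Qed.

End IteratedTrimming.

(** * Vanishing of the Klyachko elements and positivity on products of partial sums *)

Section Words.
Variable n : nat.
Local Notation P := {mpoly int[n.+1]}.
Local Notation x := (xvar n).
Local Notation u := (@u n).
Local Notation R := (@Rop n).
Local Notation T := (@Top n).
Local Notation D := (@trim_iter n).
Local Notation E := (@klyachko n).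

Lemma sum_delta (V : zmodType) m k (c : V) :
  \sum_(j < m) c *+ (j.+1 == k) = c *+ (0 < k <= m)%N.
Proof.
case: (boolP (0 < k <= m)%N) => [/andP[k0 km]|km]; last first.
  rewrite big1 // => j _; case: eqP => // e; case/negP: km.
  by rewrite -e /= ltn_ord.
have kp : (k.-1 < m)%N by lia.
rewrite (bigD1 (Ordinal kp)) //= prednK // eqxx big1 ?addr0 // => j.
by rewrite -val_eqE /= -(eqn_add2r 1) !addn1 prednK // => /negbTE->.
Qed.

(** Induction on [m]: after one trimming sum, the Klyachko multiples vanish by induction and the
    corrections cancel, except at the top index, where a multiple of [u_m] is left and vanishes
    too. *)
Lemma trim_iter_klyachko m d i f : (m <= n)%N -> (d.+2 <= m)%N -> (i <= m)%N ->
  f \is d.-homog -> D m (E i * f) = 0.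
Proof.
elim: m d i f => // m IH d i f mn dm im hf /=.
have mn' := ltnW mn.
have [->|i0] := posnP i.
  rewrite /E u0 !mul0r /trim_sum big1 ?trim_iter0 // => j _.
  by rewrite Top0 // (trim_bound j mn).
have i_n : (0 < i <= n)%N by rewrite i0 (leq_trans im).
rewrite /trim_sum trim_iter_sum //.
(* The corrections do not depend on [j] beyond their position: [a + b] at [i], [- b] at [i + 1],
   [- a] at [i - 1]. *)
pose a := D m (u i.-1 * R i f); pose b := D m (u i * R i.+1 f).
rewrite (eq_bigr (fun j : 'I_m.+1 => (a + b) *+ (j.+1 == i) - b *+ (j.+1 == i.+1)
   - a *+ (j.+1 == i.-1))); last first.
  move=> j _; have jn := trim_bound j mn.
  have DMn g (c : bool) : D m (g *+ c) = D m g *+ c.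
    by case: c; rewrite ?trim_iter0.
  rewrite Top_klyachko // !trim_iterB // trim_iterD // !DMn trim_iterD //.
  have -> : (j.+2 == i) = (j.+1 == i.-1) by case: (i) i0.
  rewrite -/a -/b [X in X + _ - _ - _](_ : _ = 0) ?add0r //.
  case: d dm hf => [|d] dm hf.
    by rewrite (homog0C hf) TopC // !mulr0 !if_same trim_iter0.
  have hT : T j.+1 f \is d.-homog by apply: Top_homog.
  have jm := ltn_ord j.
  case: ifP => h1; first by rewrite (IH d) //; lia.
  case: ifP => h2; last by rewrite trim_iter0.
  by rewrite (IH d) //; lia.
rewrite !sumrB !sum_delta i0 im /= mulr1n.
have [{}im|mi] := ltnP i m.+1.
  rewrite mulr1n addrK; have [i1|i1] := eqVneq i 1%N.
    by rewrite /a i1 /= u0 mul0r trim_iter0 // mul0rn subrr.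
  have -> : (0 < i.-1 <= m.+1)%N by lia.
  by rewrite mulr1n subrr.
(* At the top index the position [i + 1] is out of range, so [b] is not cancelled; it contains the
   factor [u_(m+1)], which [D m] kills. *)
have ei : i = m.+1 by lia.
rewrite mulr0n subr0 ei /= {}/a {}/b ei /=.
rewrite (@trim_iter_u0 _ _ d) // ?addr0; [|by apply: Rop_homog].
case: m {IH mi mn i_n im mn' ei} dm => // m dm.
by rewrite leqnSn mulr1n subrr.
Qed.

Definition uword (a : seq nat) : P := \prod_(c <- a) u c.

Lemma uword_nil : uword [::] = 1.
Proof. by rewrite /uword big_nil. Qed.

Lemma uword_cons b a : uword (b :: a) = u b * uword a.
Proof. by rewrite /uword big_cons. Qed.

Lemma uword_cat a b : uword (a ++ b) = uword a * uword b.
Proof. by rewrite /uword big_cat. Qed.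

Lemma uword_homog a : uword a \is (size a).-homog.
Proof.
elim: a => [|b a IH]; first by rewrite uword_nil dhomog1.
by rewrite uword_cons; apply: (dhomogM (u_homog n b) IH).
Qed.

Lemma Rop_uword k a : (0 < k)%N -> all (fun c => c <= n.+1)%N a ->
  R k (uword a) = uword (map (shift k) a).
Proof.
move=> k0; elim: a => [|b a IH] /=; first by rewrite uword_nil rmorph1.
by case/andP=> bn an; rewrite !uword_cons RopM Rop_u // IH.
Qed.

(** In degree [m] the iterated trimming is a constant polynomial; taking its constant coefficient
    makes it an integer-valued functional. *)
Definition trim_const m (f : P) : int := (D m f)@_0%MM.
Local Notation lam := trim_const.

Lemma trim_constD m f g : (m <= n)%N -> lam m (f + g) = lam m f + lam m g.
Proof. by move=> mn; rewrite /lam trim_iterD // mcoeffD. Qed.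

Lemma trim_const_sum (I : Type) (r : seq I) (Q : pred I) (F : I -> P) m :
  (m <= n)%N -> lam m (\sum_(i <- r | Q i) F i) = \sum_(i <- r | Q i) lam m (F i).
Proof. by move=> mn; rewrite /lam trim_iter_sum // raddf_sum. Qed.

Lemma trim_constS m f : (m < n)%N ->
  lam m.+1 f = \sum_(j < m.+1) lam m (T j.+1 f).
Proof. by move=> mn; rewrite -trim_const_sum // ltnW. Qed.

(** Leibniz deletes in turn each letter equal to [j], shifting the letters before it by [R_j] and
    those after it by [R_(j+1)]. The prefix [p] collects the letters already passed. *)
Lemma trim_const_Top_uword_ge0 m j p a : (m < n)%N -> (0 < j <= m.+1)%N ->
    (forall b, size b = m -> all (fun c => c <= m.+1)%N b -> 0 <= lam m (uword b)) ->
    (size p + size a = m.+1)%N -> all (fun c => c <= m.+1)%N p ->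
    all (fun c => c <= m.+2)%N a ->
  0 <= lam m (uword p * T j (uword a)).
Proof.
move=> mn jm IH; have jn : (0 < j <= n)%N by lia.
elim: a p => [|b a IHa] p sz pm /=.
  move=> _; rewrite uword_nil (TopC jn 1) mulr0 /lam trim_iter0 ?mcoeff0 //.
  exact: ltnW.
case/andP=> bm am.
have bn : (b <= n.+1)%N by apply: leq_trans bm _.
rewrite uword_cons TopM // mulrDr trim_constD ?(ltnW mn) //; apply: addr_ge0.
  rewrite Top_u //; case: eqP => _; last first.
    by rewrite mul0r mulr0 /lam trim_iter0 ?mcoeff0 // ltnW.
  rewrite mul1r Rop_uword //; last first.
    by apply: sub_all am => c /leq_trans; apply.
  rewrite -uword_cat; apply: IH.
    by rewrite size_cat size_map; move: sz => /=; lia.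
  rewrite all_cat pm all_map; apply: sub_all am => c /= cm.
  by rewrite /shift; case: ifP; lia.
rewrite Rop_u //; last by case/andP: jn.
rewrite mulrA [uword p * _]mulrC -uword_cons; apply: IHa => //.
  by move: sz => /=; lia.
by rewrite /= pm andbT /shift; case: ifP; lia.
Qed.

(** The letter [m.+1] is allowed because the shifts in the Leibniz expansion produce it. *)
Lemma trim_const_uword_ge0 m a : (m <= n)%N -> size a = m ->
  all (fun c => c <= m.+1)%N a -> 0 <= lam m (uword a).
Proof.
elim: m a => [|m IH] a mn.
  by move/size0nil=> -> _; rewrite uword_nil /lam /= mcoeff1 eqxx.
move=> sz am; rewrite trim_constS //; apply: sumr_ge0 => j _.
rewrite -[T _ _]mul1r -uword_nil; apply: trim_const_Top_uword_ge0 => // [|b sb bm].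
  exact: ltn_ord.
by apply: IH => //; apply: ltnW.
Qed.

(** All Leibniz terms are nonnegative, so it is enough to find one whose remaining letters lie again
    between 1 and the smaller bound. *)
Lemma trim_const_uword_gt0 m a : (m <= n)%N -> size a = m ->
  all (fun c => 0 < c <= m)%N a -> 0 < lam m (uword a).
Proof.
elim: m a => [|m IH] a mn.
  by move/size0nil=> -> _; rewrite uword_nil /lam /= mcoeff1 eqxx.
move=> sz am; rewrite trim_constS //.
have mn' := ltnW mn.
have ge0 b : size b = m -> all (fun c => c <= m.+1)%N b -> 0 <= lam m (uword b).
  exact: trim_const_uword_ge0.
have Tge0 j p b : (0 < j <= m.+1)%N -> (size p + size b = m.+1)%N ->
    all (fun c => c <= m.+1)%N p -> all (fun c => c <= m.+2)%N b ->
    0 <= lam m (uword p * T j (uword b)).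
  by move=> *; apply: trim_const_Top_uword_ge0.
have am2 : all (fun c => c <= m.+2)%N a by apply: sub_all am => c /andP[_] /leqW.
suff [j jm] : exists2 j, (j < m.+1)%N & 0 < lam m (T j.+1 (uword a)).
  move=> h; rewrite (bigD1 (Ordinal jm)) //= ltr_pwDl //; apply: sumr_ge0 => k _.
  rewrite -[T _ _]mul1r -uword_nil; apply: Tge0 => //=; exact: ltn_ord.
(* Deleting a letter [b <= m] with [T_b] works: letters above [b] drop by one and stay at least [b],
   the others are unchanged. *)
have [/hasP[b ba bm]|/hasPn nb] := boolP (has (fun c => c <= m)%N a).
  have /andP[b0 _] := allP am b ba.
  exists b.-1; first by rewrite prednK // leqW.
  have eu : uword a = uword (b :: rem b a) by apply: perm_big; apply: perm_to_rem.
  rewrite prednK // eu uword_cons TopM; [|by lia].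
  have arem : all (fun c => 0 < c <= m.+1)%N (rem b a).
    by apply/allP => c /mem_rem; apply: (allP am).
  have srem : size (rem b a) = m by rewrite size_rem // sz.
  rewrite trim_constD // ltr_pwDl //.
    rewrite Top_u ?eqxx ?mul1r ?Rop_uword //.
    - apply: IH => //; first by rewrite size_map.
      rewrite all_map; apply: sub_all arem => c /= cm.
      by rewrite /shift; case: ifP; lia.
    - by apply: sub_all arem => c; lia.
    - by lia.
    - by lia.
  rewrite Rop_u //; [|by lia].
  rewrite -[u _]mulr1 -uword_nil -uword_cons; apply: Tge0 => //=.
  - by lia.
  - by rewrite srem.
  - by rewrite /shift; case: ifP; lia.
  - by apply: sub_all arem => c; lia.
have ea : a = nseq m.+1 m.+1.
  rewrite -sz; apply/all_pred1P/allP => c ca /=.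
  by move: (nb c ca) (allP am c ca); lia.
exists m => //.
(* All letters equal [m.+1]. The deleted factor is put last so that the others undergo [R_(m+1)],
   which lowers them to [m]; [R_(m+2)] would not. *)
have -> : uword a = uword (nseq m m.+1) * u m.+1.
  by rewrite ea mulrC -uword_cons.
rewrite TopM; [|by lia].
rewrite Top_u ?eqxx ?mulr1 ?Rop_u /shift ?ltnn; [|by lia|by lia..].
rewrite trim_constD // addrC ltr_pwDl //.
  rewrite Rop_uword //; [|by rewrite all_nseq; lia].
  rewrite map_nseq /shift leqnn /=; apply: IH; rewrite ?size_nseq //.
  by rewrite all_nseq leqnn andbT; case: (m).
rewrite mulrC -[u _]mulr1 -uword_nil -uword_cons; apply: Tge0 => //=.
- by rewrite size_nseq.
- by rewrite leqnn.
- by rewrite all_nseq leqnSn orbT.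
Qed.

End Words.

(** * Braid relations *)

Section Braid.
Variable n : nat.
Local Notation P := {mpoly int[n.+1]}.
Implicit Types (i j : 'I_n) (f g : P).

Lemma permvarsM (s : 'S_n.+1) f g : permvars s (f * g) = permvars s f * permvars s g.
Proof. exact: rmorphM. Qed.

Lemma permvarsB (s : 'S_n.+1) f g : permvars s (f - g) = permvars s f - permvars s g.
Proof. exact: rmorphB. Qed.

(** Multiplied by [alpha i * alpha j], both sides become the signed sum of [f] over the group
    generated by the two commuting transpositions. *)
Lemma ddiff_commute i j f : (i.+1 < j)%N ->
  ddiff i (ddiff j f) = ddiff j (ddiff i f).
Proof.
move=> ij; set s := permvars (simple i); set t := permvars (simple j).
have neq : [/\ sfirst i != sfirst j, sfirst i != ssecond j,
    ssecond i != sfirst j & ssecond i != ssecond j].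
  by split; rewrite -val_eqE /= /bump /=; lia.
have st g : s (t g) = t (s g).
  rewrite /s /t !permvars_comp; congr (permvars _ g).
  case: neq => n1 n2 n3 n4; rewrite conjgC; congr (_ * _)%g.
  by rewrite /simple tpermJ !tpermD // eq_sym.
have sr : s (alpha j) = alpha j.
  by case: neq => n1 n2 n3 n4; rewrite /s {1}/alpha permvarsB !permvarsX /simple !tpermD.
have tr : t (alpha i) = alpha i.
  by case: neq => n1 n2 n3 n4; rewrite /t {1}/alpha permvarsB !permvarsX /simple !tpermD // eq_sym.
apply: (mulfI (alpha_neq0 i)); apply: (mulfI (alpha_neq0 j)).
have L : alpha j * (alpha i * ddiff i (ddiff j f)) = f - t f - (s f - s (t f)).
  have es g : alpha j * s g = s (alpha j * g) by rewrite /s permvarsM -/s sr.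
  by rewrite ddiffE -/s mulrBr es ddiffE -/t /s permvarsB.
have R : alpha i * (alpha j * ddiff j (ddiff i f)) = f - s f - (t f - t (s f)).
  have es g : alpha i * t g = t (alpha i * g) by rewrite /t permvarsM -/t tr.
  by rewrite ddiffE -/t mulrBr es ddiffE -/s /t permvarsB.
rewrite L mulrCA R st.
by move: (s f) (t f) (t (s f)) => *; ring.
Qed.

Lemma simple_braid i j : j = i.+1 :> nat ->
  (simple i * (simple j * simple i) = simple j * (simple i * simple j))%g.
Proof.
move=> ji; have bj : sfirst j = ssecond i by apply: val_inj; rewrite /= /bump /=; lia.
have ac : sfirst i != ssecond j by rewrite -val_eqE /= /bump /=; lia.
have := sfirst_ssecond i; have := sfirst_ssecond j; rewrite /simple bj => bc ab.
rewrite [in LHS](conjgC (tperm (ssecond i) _)) [in RHS](conjgC (tperm (sfirst i) _)).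
rewrite !tpermJ !mulgA !tperm2 !mul1g tpermL tpermR tpermD // 1?eq_sym //.
by rewrite tpermD 1?eq_sym.
Qed.

(** Multiplied by the product [V] of the three differences of the variables involved, both sides
    become the signed sum of [f] over the six permutations of these variables. *)
Lemma ddiff_braid i j f : j = i.+1 :> nat ->
  ddiff i (ddiff j (ddiff i f)) = ddiff j (ddiff i (ddiff j f)).
Proof.
move=> ji; set s := permvars (simple i); set t := permvars (simple j).
have bj : sfirst j = ssecond i by apply: val_inj; rewrite /= /bump /=; lia.
have ac : sfirst i != ssecond j by rewrite -val_eqE /= /bump /=; lia.
have := sfirst_ssecond i; have := sfirst_ssecond j; rewrite bj => bc ab.
pose a : P := 'X_(sfirst i); pose b : P := 'X_(ssecond i); pose c : P := 'X_(ssecond j).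
have sts g : s (t (s g)) = t (s (t g)).
  by rewrite /s /t !permvars_comp simple_braid.
have ri : alpha i = a - b by [].
have rj : alpha j = b - c by rewrite /alpha bj.
have sb : s (b - c) = a - c.
  by rewrite /s permvarsB !permvarsX /simple tpermR tpermD // eq_sym.
have ta : t (a - b) = a - c.
  by rewrite /t permvarsB !permvarsX /simple bj tpermL tpermD // eq_sym.
have tac : t (a - c) = a - b.
  by rewrite /t permvarsB !permvarsX /simple bj tpermR tpermD // eq_sym.
have sac : s (a - c) = b - c.
  by rewrite /s permvarsB !permvarsX /simple tpermL tpermD // eq_sym.
have E1 g : (a - b) * ddiff i g = g - s g by rewrite -ri ddiffE.
have E2 g : (b - c) * ddiff j g = g - t g by rewrite -rj ddiffE.
have ac0 : a - c != 0.
  by rewrite subr_eq0; apply/eqP => /mpolyXI/eqP; rewrite (negbTE ac).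
have E3 g : (a - c) * t (ddiff i g) = t g - t (s g).
  by rewrite -ta -permvarsM E1 permvarsB.
have E4 g : (a - c) * s (ddiff j g) = s g - s (t g).
  by rewrite -sb -permvarsM E2 permvarsB.
have E5 g : (b - c) * s (t (ddiff i g)) = s (t g) - s (t (s g)).
  by rewrite -sac -permvarsM E3 permvarsB.
have E6 g : (a - b) * t (s (ddiff j g)) = t (s g) - t (s (t g)).
  by rewrite -tac -permvarsM E4 permvarsB.
pose V := (a - b) * (b - c) * (a - c).
have V0 : V != 0 by rewrite /V !mulf_neq0 // -?ri -?rj alpha_neq0.
apply: (mulfI V0).
have L : V * ddiff i (ddiff j (ddiff i f)) = f - s f - t f + t (s f) + s (t f) - s (t (s f)).
  have sA : s (ddiff i f) = ddiff i f by exact: permvars_ddiff.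
  move: (ddiff i f) (E1 f) (E3 f) (E5 f) sA => A eA1 eA3 eA5 sA.
  move: (ddiff j A) (E2 A) (E4 A) => B eB2 eB4.
  have -> : V * ddiff i B = (b - c) * (a - c) * ((a - b) * ddiff i B).
    by rewrite /V; move: (ddiff i B) (a - b) (b - c) (a - c) => *; ring.
  have -> : (b - c) * (a - c) * ((a - b) * ddiff i B) =
      (a - c) * ((b - c) * B) - (b - c) * ((a - c) * s B).
    by rewrite E1; move: (s B) (b - c) (a - c) => *; ring.
  rewrite eB2 eB4 sA.
  have -> : (a - c) * (A - t A) - (b - c) * (A - s (t A)) =
      (a - b) * A - (a - c) * t A + (b - c) * s (t A).
    by move: (s (t A)) (t A) => *; ring.
  by rewrite eA1 eA3 eA5; move: (s (t (s f))) (s (t f)) (t (s f)) (s f) (t f) => *; ring.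
have R : V * ddiff j (ddiff i (ddiff j f)) = f - s f - t f + t (s f) + s (t f) - t (s (t f)).
  have tA : t (ddiff j f) = ddiff j f by exact: permvars_ddiff.
  move: (ddiff j f) (E2 f) (E4 f) (E6 f) tA => A eA1 eA3 eA5 tA.
  move: (ddiff i A) (E1 A) (E3 A) => B eB2 eB4.
  have -> : V * ddiff j B = (a - b) * (a - c) * ((b - c) * ddiff j B).
    by rewrite /V; move: (ddiff j B) (a - b) (b - c) (a - c) => *; ring.
  have -> : (a - b) * (a - c) * ((b - c) * ddiff j B) =
      (a - c) * ((a - b) * B) - (a - b) * ((a - c) * t B).
    by rewrite E2; move: (t B) (a - b) (a - c) => *; ring.
  rewrite eB2 eB4 tA.
  have -> : (a - c) * (A - s A) - (a - b) * (A - t (s A)) =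
      (b - c) * A - (a - c) * s A + (a - b) * t (s A).
    by move: (t (s A)) (s A) => *; ring.
  by rewrite eA1 eA3 eA5; move: (t (s (t f))) (s (t f)) (t (s f)) (s f) (t f) => *; ring.
by rewrite L R sts.
Qed.
End Braid.

(** * Schubert polynomials *)

Section Schubert.
Variable n : nat.
Local Notation P := {mpoly int[n.+1]}.
Implicit Types (w : 'S_n.+1) (i j : 'I_n).
Local Notation N := 'C(n.+1, 2).

Definition ascent w i := (w (sfirst i) < w (ssecond i))%N.

Lemma mul_sE w i k : mul_s w i k = w (simple i k).
Proof. by rewrite /mul_s permM. Qed.

Lemma mul_sK w i : mul_s (mul_s w i) i = w.
Proof. by rewrite /mul_s mulgA tperm2 mul1g. Qed.

Lemma ascent_mul_s w i : ascent (mul_s w i) i = ~~ ascent w i.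
Proof.
rewrite /ascent !mul_sE tpermL tpermR -leqNgt ltn_neqAle.
rewrite (_ : (_ != _ :> nat) = true) //.
by rewrite (inj_eq val_inj) (inj_eq perm_inj) eq_sym sfirst_ssecond.
Qed.

Lemma ascent_mul_s_far w i j : (i.+1 < j)%N || (j.+1 < i)%N ->
  ascent (mul_s w j) i = ascent w i.
Proof.
by move=> ij; rewrite /ascent !mul_sE /simple !tpermD // -val_eqE /= /bump /=; lia.
Qed.

Definition inversions w :=
  [set p : 'I_n.+1 * 'I_n.+1 | (p.1 < p.2)%N && (w p.2 < w p.1)%N].

(** Applying the transposition to both entries of a pair matches the inversions of the product,
    other than the new one [ab], with those of [w]: only the pair [ab] and its reverse change
    order. *)
Lemma len_mul_s w i : ascent w i -> len (mul_s w i) = (len w).+1.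
Proof.
move=> aw; rewrite /len -!/(inversions _).
pose t := simple i; pose ab := (sfirst i, ssecond i).
pose phi (p : 'I_n.+1 * 'I_n.+1) := (t p.1, t p.2).
have phi_inj : injective phi by move=> [? ?] [? ?] [/perm_inj-> /perm_inj->].
have abI : ab \in inversions (mul_s w i).
  by rewrite inE !mul_sE tpermL tpermR; apply/andP; split => //=.
rewrite (cardsD1 ab) abI add1n -(card_preimset (inversions w) phi_inj); congr _.+1.
apply: eq_card => -[k l]; rewrite !inE /= !mul_sE.
have sa : (ssecond i = i.+1 :> nat) by [].
have [[-> ->]|nab] := altP ((k, l) =P ab).
  by rewrite /= /t tpermL tpermR sa /= ltnNge ltnW.
rewrite /=; have [[-> ->]|nba] := altP ((k, l) =P (ssecond i, sfirst i)).
  have wba : (w (ssecond i) < w (sfirst i))%N = false by apply/negbTE; rewrite -leqNgt ltnW.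
  by rewrite /t tpermL tpermR wba !andbF.
congr (_ && _).
have tn (p : 'I_n.+1) : t p = (if p == i :> nat then i.+1
                               else if p == i.+1 :> nat then i : nat else p) :> nat.
  rewrite /t /simple; case: tpermP => [->|->|/eqP + /eqP +].
  - by rewrite eqxx.
  - by rewrite sa eqxx (gtn_eqF (ltnSn i)).
  - by rewrite -!val_eqE /= /bump /= add1n => /negbTE-> /negbTE->.
rewrite !tn; move: nab nba; rewrite /ab !xpair_eqE -!val_eqE /= /bump /= add1n.
by do ![case: eqP => //=]; lia.
Qed.

Lemma card_lt_pairs m : #|[set p : 'I_m * 'I_m | (p.1 < p.2)%N]| = 'C(m, 2).
Proof.
rewrite -sum1dep_card -(pair_big_dep predT (fun i j : 'I_m => (i < j)%N) (fun _ _ => 1%N)) /=.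
rewrite (exchange_big_dep predT) //= -bin2_sum big_mkord; apply: eq_bigr => j _.
rewrite sum1_card -[RHS]card_ord -(card_image (f := widen_ord (ltnW (ltn_ord j)))).
  apply: eq_card => k; apply/idP/imageP => [kj|[l _ ->]].
    by exists (Ordinal (kj : (k < j)%N)) => //; apply: val_inj.
  exact: ltn_ord l.
by move=> k l /(congr1 val) /= kl; apply: val_inj.
Qed.

Lemma len_le w : (len w <= N)%N.
Proof.
rewrite -card_lt_pairs; apply: subset_leq_card; apply/subsetP => p.
by rewrite !inE => /andP[].
Qed.

Lemma ord_chain (Q : 'I_n.+1 -> 'I_n.+1 -> Prop) :
  (forall a b c, Q a b -> Q b c -> Q a c) ->
  (forall i, Q (sfirst i) (ssecond i)) -> forall k l : 'I_n.+1, (k < l)%N -> Q k l.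
Proof.
move=> Qtr Qs k l kl.
have [d e] : exists d, (l : nat) = (k + d.+1)%N by exists (l - k).-1; lia.
elim: d l e {kl} => [|d IH] l e.
  have kn : (k < n)%N by have := ltn_ord l; lia.
  have -> : k = sfirst (Ordinal kn) by apply: val_inj.
  have -> : l = ssecond (Ordinal kn) by apply: val_inj; rewrite /= /bump /=; lia.
  exact: Qs.
have kn : (k + d.+1 < n)%N by have := ltn_ord l; lia.
have -> : l = ssecond (Ordinal kn) by apply: val_inj; rewrite /= /bump /=; lia.
by apply: Qtr (Qs _); apply: IH.
Qed.

Lemma len_no_ascent w : (forall i, ~~ ascent w i) -> len w = N.
Proof.
move=> na; rewrite -card_lt_pairs; apply: eq_card => -[k l]; rewrite !inE /=.
case: ltnP => //= kl; move: k l kl.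
apply: (ord_chain (Q := fun k l => (w l < w k)%N)) => [a b c ab bc|i].
  exact: ltn_trans bc ab.
by have := na i; rewrite -ascent_mul_s /ascent !mul_sE tpermL tpermR.
Qed.

Lemma len_all_ascent w : (forall i, ascent w i) -> len w = 0%N.
Proof.
move=> aw; have mono : forall k l : 'I_n.+1, (k < l)%N -> (w k < w l)%N.
  exact: (ord_chain (Q := fun k l => (w k < w l)%N)) (fun _ _ _ => @ltn_trans _ _ _) aw.
apply/eqP; rewrite cards_eq0; apply/eqP/setP => -[k l]; rewrite !inE /=.
by case: ltnP => //= /mono kl; rewrite ltnNge ltnW.
Qed.

Lemma schubert_pick w : (exists i, ascent w i) ->
  exists2 i, ascent w i & schubert w = ddiff i (schubert (mul_s w i)).
Proof.
case=> i0 a0; have [l0 b0] := (len_mul_s a0, len_le (mul_s w i0)).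
rewrite {1}/schubert; have -> : (N - len w = (N - len w).-1.+1)%N by lia.
rewrite /=; case: pickP => [i ai|/(_ i0)]; last by rewrite -/(ascent _ _) a0.
exists i => //; rewrite /schubert; congr (ddiff _ (schub_aux _ _)).
by rewrite len_mul_s //; lia.
Qed.

Lemma schubert_no_ascent w : (forall i, ~~ ascent w i) -> schubert w = staircase n.
Proof. by move=> na; rewrite /schubert len_no_ascent // subnn. Qed.

(* Independence of the chosen ascent: two ascents are joined by the commutation
   or the braid relation. *)
Lemma schubert_ascent w i : ascent w i -> schubert w = ddiff i (schubert (mul_s w i)).
Proof.
move: {2}(N - len w)%N (erefl (N - len w)%N) => k.
(* Induction on the colength, which each multiplication at an ascent lowers. *)
elim/ltn_ind: k w i => k IH w i ke ai.
have lt_k v j : ascent v j -> (N - len (mul_s v j) < N - len v)%N.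
  by move=> av; have := len_mul_s av; have := len_le (mul_s v j); lia.
have {}IH v j : (N - len v < k)%N -> ascent v j ->
    schubert v = ddiff j (schubert (mul_s v j)) by move=> vk; apply: (IH _ vk).
have [j aj ->] := schubert_pick (ex_intro _ i ai).
have far v (p q : 'I_n) : (p.+1 < q)%N -> ascent v p -> ascent v q -> (N - len v <= k)%N ->
    ddiff p (schubert (mul_s v p)) = ddiff q (schubert (mul_s v q)).
  move=> pq ap aq vk; have qp : (p.+1 < q)%N || (q.+1 < p)%N by rewrite pq.
  have qp' : (q.+1 < p)%N || (p.+1 < q)%N by rewrite pq orbT.
  have a1 : ascent (mul_s v p) q by rewrite ascent_mul_s_far.
  have b1 : ascent (mul_s v q) p by rewrite ascent_mul_s_far.
  have h1 := leq_trans (lt_k _ _ ap) vk; have h2 := leq_trans (lt_k _ _ aq) vk.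
  rewrite (IH _ _ h1 a1) (IH _ _ h2 b1).
  rewrite (ddiff_commute _ pq); congr (ddiff _ (ddiff _ (schubert _))).
  rewrite /mul_s !mulgA; congr (_ * _)%g.
  rewrite [LHS]conjgC tpermJ !tpermD // -val_eqE /= /bump /=; lia.
have near v (p q : 'I_n) : q = p.+1 :> nat -> ascent v p -> ascent v q -> (N - len v <= k)%N ->
    ddiff p (schubert (mul_s v p)) = ddiff q (schubert (mul_s v q)).
  move=> pq ap aq vk.
  have e : sfirst q = ssecond p by apply: val_inj; rewrite /= /bump /=; lia.
  have ac : sfirst p != ssecond q by rewrite -val_eqE /= /bump /=; lia.
  have bc : ssecond p != ssecond q by rewrite -e sfirst_ssecond.
  have ab := sfirst_ssecond p; have ca : ssecond q != sfirst p by rewrite eq_sym.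
  have ba : ssecond p != sfirst p by rewrite eq_sym.
  move: (ap) (aq); rewrite /ascent e => vab vbc; have vac := ltn_trans vab vbc.
  have a1 : ascent (mul_s v p) q.
    by rewrite /ascent !mul_sE /simple e tpermR (tpermD ac bc).
  have a2 : ascent (mul_s (mul_s v p) q) p.
    by rewrite /ascent !mul_sE /simple e (tpermD ba ca) !tpermL (tpermD ac bc).
  have b1 : ascent (mul_s v q) p.
    by rewrite /ascent !mul_sE /simple e tpermL (tpermD ba ca).
  have b2 : ascent (mul_s (mul_s v q) p) q.
    by rewrite /ascent !mul_sE /simple e tpermR (tpermD ba ca) (tpermD ac bc) tpermR.
  have h1 := leq_trans (lt_k _ _ ap) vk; have h2 := leq_trans (lt_k _ _ aq) vk.
  have h3 := ltn_trans (lt_k _ _ a1) h1; have h4 := ltn_trans (lt_k _ _ b1) h2.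
  rewrite (IH _ _ h1 a1) (IH _ _ h3 a2) (IH _ _ h2 b1) (IH _ _ h4 b2).
  rewrite (ddiff_braid _ pq); congr (ddiff _ (ddiff _ (ddiff _ (schubert _)))).
  by rewrite /mul_s !mulgA; congr (_ * _)%g; rewrite -!mulgA simple_braid.
have [ij|ij|ij] := ltngtP i j.
- have [e|ne] := eqVneq (j : nat) i.+1; first by rewrite -(near w i j) // ke.
  by rewrite -(far w i j) ?ke //; lia.
- have [e|ne] := eqVneq (i : nat) j.+1; first by rewrite (near w j i) // ke.
  by rewrite (far w j i) ?ke //; lia.
- by rewrite (val_inj ij).
Qed.

End Schubert.

(** * Divided differences, degrees and normalization of Schubert polynomials *)

Section SchubertIdentity.
Variable n : nat.
Local Notation P := {mpoly int[n.+1]}.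
Implicit Types (w : 'S_n.+1) (i j : 'I_n).
Local Notation N := 'C(n.+1, 2).

(** At an ascent [d_i] is applied twice, which gives 0; at a descent the recursion is read at
    [mul_s w i]. *)
Lemma ddiff_schubert w i :
  ddiff i (schubert w) = if ascent w i then 0 else schubert (mul_s w i).
Proof.
case: ifP => ai; first by rewrite (schubert_ascent ai) ddiff_ddiff.
have ai' : ascent (mul_s w i) i by rewrite ascent_mul_s ai.
by rewrite (schubert_ascent ai') mul_sK.
Qed.

Lemma len_descent w i : ~~ ascent w i -> len w = (len (mul_s w i)).+1.
Proof.
move=> ai; have ai' : ascent (mul_s w i) i by rewrite ascent_mul_s.
by rewrite -(len_mul_s ai') mul_sK.
Qed.

Lemma homog_prod_ord m (f : 'I_m -> P) (d : 'I_m -> nat) :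
  (forall k, f k \is (d k).-homog) -> \prod_k f k \is (\sum_k d k)%N.-homog.
Proof.
move=> h; elim/big_ind2: _ => //; first exact: dhomog1.
by move=> *; apply: dhomogM.
Qed.

Lemma staircase_homog : staircase n \is N.-homog.
Proof.
have -> : N = (\sum_(j < n.+1) (n - j))%N.
  rewrite -bin2_sum big_mkord (reindex_inj rev_ord_inj) /=.
  by apply: eq_bigr => k _; rewrite subSS.
by apply: homog_prod_ord => k; have := dhomogMn (n - k) (homogX k); rewrite mul1n.
Qed.

Lemma schubert_homog w : schubert w \is (len w).-homog.
Proof.
move: {2}(N - len w)%N (erefl (N - len w)%N) => k.
elim: k w => [|k IH] w kw.
  rewrite /schubert kw /=; have := len_le w; move: kw => /eqP; rewrite subn_eq0.
  by move=> h1 h2; rewrite (_ : len w = N) ?staircase_homog //; apply/eqP; rewrite eqn_leq h1 h2.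
have [/existsP|/existsPn na] := boolP [exists i, ascent w i].
  move=> ea; have [i ai ->] := schubert_pick ea.
  by apply: ddiff_homog; rewrite -(len_mul_s ai); apply: IH; rewrite (len_mul_s ai); lia.
by move: kw; rewrite len_no_ascent // subnn.
Qed.

Lemma len0_perm1 w : len w = 0%N -> w = 1%g.
Proof.
move/eqP; rewrite cards_eq0 => /eqP w0.
have mono (k l : 'I_n.+1) : (k < l)%N -> (w k < w l)%N.
  move=> kl; rewrite ltnNge; apply/negP; rewrite leq_eqVlt => /orP[|lk].
    by rewrite (inj_eq val_inj) (inj_eq perm_inj) => /eqP e; rewrite e ltnn in kl.
  by have := in_set0 (k, l); rewrite -w0 inE /= kl lk.
(* An increasing permutation moves no index down; applied to [w] and to its inverse, this forces the
   identity. *)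
have ge (v : 'S_n.+1) : (forall k l : 'I_n.+1, (k < l)%N -> (v k < v l)%N) ->
    forall k : 'I_n.+1, (k <= v k)%N.
  move=> vm [k kn]; elim: k kn => // k IH kn.
  have h := vm (Ordinal (ltnW kn)) (Ordinal kn) (ltnSn k).
  by apply: leq_ltn_trans h; apply: IH.
apply/permP => k; rewrite perm1; apply/val_inj/anti_leq; rewrite (ge _ mono) andbT.
have monoV (a b : 'I_n.+1) : (a < b)%N -> (w^-1%g a < w^-1%g b)%N.
  move=> ab; rewrite ltnNge; apply/negP; rewrite leq_eqVlt => /orP[|/mono].
    by rewrite (inj_eq val_inj) (inj_eq perm_inj) => /eqP e; rewrite e ltnn in ab.
  by rewrite !permKV ltnNge ltnW.
by have := ge _ monoV (w k); rewrite permK.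
Qed.

(* The monomials met when the staircase is reduced by applying the divided
   differences d_1, .., d_(r-1) to x^(r-1, .., 1, 0), for r = n+1, .., 2 in turn. *)
Definition stair r p : P := \prod_(j < n.+1) 'X_j ^+ (r - j.+1 - (j < p)).

Lemma stair_neq0 r p : stair r p != 0.
Proof.
by apply/prodf_neq0 => j _; rewrite expf_neq0 // xvarE xvar_neq0.
Qed.

(** In [stair r i.+1] the variables at [i] and [i.+1] have the same exponent, so it is a symmetric
    factor and [d_i] acts only on the one extra variable. *)
Lemma ddiff_stair r i : (i.+1 < r)%N -> ddiff i (stair r i) = stair r i.+1.
Proof.
move=> ir; have -> : stair r i = 'X_(sfirst i) * stair r i.+1.
  have D p : stair r p = 'X_(sfirst i) ^+ (r - i.+1 - (i < p)) *
      \prod_(j < n.+1 | j != sfirst i) 'X_j ^+ (r - j.+1 - (j < p)).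
    exact: (bigD1 (sfirst i)).
  rewrite (D i) (D i.+1) mulrA -exprS ltnn ltnSn; congr (_ ^+ _ * _); first by lia.
  apply: eq_bigr => j; rewrite -val_eqE /= => ji.
  by rewrite ltnS [in RHS]leq_eqVlt (negbTE ji).
rewrite ddiffM [ddiff i (stair _ _)]ddiff_sym ?mulr0 ?addr0; last first.
  rewrite /stair rmorph_prod (reindex_inj (@perm_inj _ (simple i))) /=.
  apply: eq_bigr => j _; rewrite rmorphXn /= permvarsX tpermK.
  congr (_ ^+ _); rewrite /simple; case: tpermP => [->|->|//] /=; rewrite /bump /=.
    by lia.
  by lia.
rewrite (_ : ddiff i 'X_(sfirst i) = 1) ?mul1r //.
by apply: ddiff_eq; rewrite mulr1 permvarsX tpermL.
Qed.

(** A divided difference of a Schubert polynomial is 0 or a Schubert polynomial, and a monomial is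
    not 0. *)
Lemma schubert_stairS r p : (p.+1 < r <= n.+1)%N ->
  (exists w, schubert w = stair r p) -> exists w, schubert w = stair r p.+1.
Proof.
move=> pr [w ew]; have pn : (p < n)%N by lia.
have := ddiff_schubert w (Ordinal pn); rewrite ew ddiff_stair; last by case/andP: pr.
case: ifP => _ e; last by exists (mul_s w (Ordinal pn)).
by have := stair_neq0 r p.+1; rewrite e eqxx.
Qed.

Lemma schubert_stair r p : (0 < r <= n.+1)%N -> (p < r)%N ->
  exists w, schubert w = stair r p.
Proof.
case/andP=> r0 rn; elim: p => [|p IHp] pr; last first.
  by apply: schubert_stairS; [lia|apply: IHp; lia].
have [k kr] : exists k, (r + k = n.+1)%N by exists (n.+1 - r)%N; lia.
elim: k r r0 {rn pr} kr => [|k IH] r r0 kr.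
  exists (perm rev_ord_inj); rewrite schubert_no_ascent => [|i]; last first.
    by rewrite /ascent !permE /= /bump /=; lia.
  by apply: eq_bigr => j _; rewrite ltn0 subn0; congr (_ ^+ _); lia.
have [w ew] : exists w, schubert w = stair r.+1 r.
  have [w0 ew0] : exists w, schubert w = stair r.+1 0 by apply: IH; lia.
  suff h p : (p < r.+1)%N -> exists w, schubert w = stair r.+1 p by apply: h.
  elim: p => [_|p IHp pr]; first by exists w0.
  by apply: schubert_stairS; [lia|apply: IHp; lia].
(* A completed pass from [r.+1] ends where the next one starts: [stair r.+1 r] is [stair r 0]. *)
exists w; rewrite ew; apply: eq_bigr => j _; congr (_ ^+ _).
by case: ltnP; lia.
Qed.

(** The descent from the staircase shows that 1 is the Schubert polynomial of some [w]; its degree 0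
    forces [len w = 0], hence [w] is the identity. *)
Lemma schubert1 : schubert (1%g : 'S_n.+1) = 1.
Proof.
have [//|//|w ew] := @schubert_stair 1 0.
have e1 : stair 1 0 = 1.
  by apply: big1 => j _; rewrite subSS sub0n sub0n expr0.
move: ew; rewrite e1 => ew; rewrite -(@len0_perm1 w) //.
apply: (@dhomog_uniq _ _ mdeg (1 : P)); first exact: oner_neq0.
  by rewrite -ew; apply: schubert_homog.
exact: dhomog1.
Qed.

End SchubertIdentity.

(** * Positivity of the iterated trimming of a Schubert polynomial *)

Section Euler.
Variable n : nat.
Local Notation P := {mpoly int[n.+1]}.
Local Notation u := (@u n).
Local Notation lam := (@trim_const n n).

Lemma ddiffB (i : 'I_n) (f g : P) : ddiff i (f - g) = ddiff i f - ddiff i g.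
Proof. exact: (@tderB n idfun _ _ (alpha_neq0 i) (@ddiff_divides n i)). Qed.

Lemma ddiffZ (i : 'I_n) c (f : P) : ddiff i (c *: f) = c *: ddiff i f.
Proof. by rewrite -!mul_mpolyC ddiffM ddiffC mul0r add0r -[c]intz !rmorph_int. Qed.

Lemma ddiffD (i : 'I_n) (f g : P) : ddiff i (f + g) = ddiff i f + ddiff i g.
Proof.
have eN : ddiff i (- g) = - ddiff i g.
  by rewrite -[X in ddiff i X]scaleN1r ddiffZ scaleN1r.
by rewrite -{1}[g]opprK ddiffB eN opprK.
Qed.

Lemma alpha_xvar (i : 'I_n) : alpha i = xvar n i.+1 - xvar n i.+2.
Proof. by rewrite /alpha !xvarE. Qed.

Lemma ddiffX (i : 'I_n) (j : 'I_n.+1) :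
  ddiff i 'X_j = (i == j :> nat)%:R - (i.+1 == j :> nat)%:R.
Proof.
apply: ddiff_eq; rewrite permvarsX; case: tpermP => [->|->|/eqP ja /eqP jb].
- by rewrite eqxx (gtn_eqF (ltnSn i)) subr0 mulr1.
- by rewrite /= /bump /= add1n eqxx (ltn_eqF (ltnSn i)) sub0r mulrN1 opprB.
have -> : (i == j :> nat) = false by apply/negbTE; rewrite eq_sym.
have -> : (i.+1 == j :> nat) = false.
  by apply/negbTE; move: jb; rewrite -val_eqE /= /bump /= add1n eq_sym.
by rewrite !subrr mulr0.
Qed.

Definition euler (f : P) : P := \sum_(i < n) u i.+1 * ddiff i f.

(** Only two terms survive, with difference [u j.+1 - u j]. For the last variable the first one is
    absent, which costs [u n.+1]. *)
Lemma eulerX (j : 'I_n.+1) : euler 'X_j = 'X_j - u n.+1 *+ (j == n :> nat).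
Proof.
rewrite /euler (eq_bigr (fun i : 'I_n => u j.+1 *+ (i.+1 == j.+1) - u j *+ (i.+1 == j))).
  have xj : 'X_j = u j.+1 - u j by rewrite xvarE uS addrAC subrr add0r.
  have uj : u j *+ (0 < j <= n)%N = u j.
    have := ltn_ord j; rewrite ltnS => ->; rewrite andbT.
    by case: posnP => [->|_]; rewrite ?u0 ?mul0rn.
  rewrite sumrB !sum_delta uj xj; case: eqP => [->|nj].
    by rewrite ltnn mulr0n mulr1n sub0r addrAC subrr sub0r.
  have -> : (0 < j.+1 <= n)%N by have := ltn_ord j; lia.
  by rewrite mulr1n mulr0n subr0.
move=> i _; rewrite ddiffX eqSS mulrBr !mulr_natr.
by congr (_ - _); [case: eqP => // ->|case: eqP => // ->].
Qed.

(** The defect of the ordinary Leibniz rule comes from [s_i x_j = x_j - alpha_i d_i x_j]; together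
    with the weight [u_i] it is a Klyachko multiple. *)
Lemma eulerXM (j : 'I_n.+1) f : euler ('X_j * f) =
  euler 'X_j * f + 'X_j * euler f - \sum_(i < n) klyachko n i.+1 * (ddiff i 'X_j * ddiff i f).
Proof.
rewrite /euler mulr_suml mulr_sumr -big_split /= -sumrB; apply: eq_bigr => i _.
have sX : permvars (simple i) 'X_j = 'X_j - alpha i * ddiff i 'X_j by rewrite ddiffE subKr.
rewrite ddiffM sX /klyachko -alpha_xvar.
by move: (u i.+1) (ddiff i f) (ddiff i 'X_j) (alpha i) => *; ring.
Qed.

Lemma euler0 : euler 0 = 0.
Proof. by apply: big1 => i _; rewrite -(mpolyC0 n.+1 int) ddiffC mulr0. Qed.

Lemma eulerD f g : euler (f + g) = euler f + euler g.
Proof. by rewrite /euler -big_split; apply: eq_bigr => i _; rewrite ddiffD mulrDr. Qed.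

Lemma eulerZ c f : euler (c *: f) = c *: euler f.
Proof. by rewrite /euler scaler_sumr; apply: eq_bigr => i _; rewrite ddiffZ scalerAr. Qed.

Lemma trim_constB f g : lam (f - g) = lam f - lam g.
Proof. by rewrite /trim_const trim_iterB // mcoeffB. Qed.

Lemma trim_const0 : lam 0 = 0.
Proof. by rewrite /trim_const trim_iter0 ?mcoeff0. Qed.

Lemma trim_constMn f k : lam (f *+ k) = lam f *+ k.
Proof.
elim: k => [|k IH]; first by rewrite !mulr0n trim_const0.
by rewrite !mulrS trim_constD // IH.
Qed.

Lemma trim_constZ c f : lam (c *: f) = c * lam f.
Proof.
have H k : lam (k%:Z *: f) = k%:Z * lam f.
  by rewrite -natz scaler_nat trim_constMn mulr_natl.
case: (intP c) => [|k|k]; [by rewrite scale0r mul0r trim_const0|exact: H|].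
by rewrite scaleNr mulNr -H -[- _]sub0r trim_constB trim_const0 sub0r.
Qed.

(* Modulo the ideal killed by [trim_const], the operator [euler] is a
   derivation, and it fixes the variables. *)
Lemma trim_const_euler d e f g : f \is d.-homog -> g \is e.-homog -> (e + d)%N = n ->
  lam (g * euler f) = lam (g * f) *+ d.
Proof.
move=> hf; move: d f hf e g.
apply: (@homog_ind n (fun d f => forall e g, g \is e.-homog -> (e + d)%N = n ->
  lam (g * euler f) = lam (g * f) *+ d)).
- by move=> d e g _ _; rewrite euler0 !mulr0 trim_const0 mul0rn.
- move=> d f1 f2 h1 h2 e g hg ed; rewrite eulerD !mulrDr !trim_constD //.
  by rewrite mulrnDl; congr (_ + _); [exact: (h1 _ _ hg ed)|exact: (h2 _ _ hg ed)].
- move=> d c f h e g hg ed; rewrite eulerZ -!scalerAr !trim_constZ.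
  by rewrite (h _ _ hg ed) mulrnAr.
- by move=> e g _ _; rewrite /euler big1 ?mulr0 ?trim_const0 // => i _;
    rewrite -(mpolyC1 n.+1 int) ddiffC mulr0.
move=> d j f hf IH e g hg ed; rewrite eulerXM eulerX.
have lk : lam (g * \sum_(i < n) klyachko n i.+1 * (ddiff i 'X_j * ddiff i f)) = 0.
  rewrite mulr_sumr /trim_const trim_iter_sum // big1 ?mcoeff0 // => i _.
  rewrite mulrCA; case: d hf ed {IH} => [|d] hf ed.
    by rewrite (homog0C hf) ddiffC !mulr0 trim_iter0.
  apply: (@trim_iter_klyachko _ _ (e + d)) => //; first by lia.
  apply: (dhomogM hg); rewrite -[d]add0n; apply: dhomogM; last exact: ddiff_homog.
  by rewrite ddiffX; apply: rpredB; case: eqP => _; rewrite ?dhomog0 ?dhomog1.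
have lu : lam (g * ((u n.+1 *+ (j == n :> nat)) * f)) = 0.
  case: eqP => _; last by rewrite mulr0n mul0r mulr0 trim_const0.
  rewrite mulr1n mulrCA /trim_const (@trim_iter_u0 _ _ (e + d)) ?mcoeff0 //.
    by lia.
  exact: dhomogM.
(* The variable is absorbed into the multiplier, which is why the induction quantifies over [g]. *)
have hX : g * 'X_j \is (e + 1).-homog by apply: dhomogM => //; apply: homogX.
have := IH _ _ hX; rewrite -addnA add1n => /(_ ed) IHj.
rewrite mulrBr trim_constB lk subr0 mulrDr trim_constD //.
rewrite mulrBl mulrBr trim_constB lu subr0.
by rewrite [g * (_ * euler f)]mulrA IHj mulrS -mulrA.
Qed.

(** Each use of [euler] moves one letter of a reduced word of [w] into the prefix [a], until the
    identity permutation leaves a product of partial sums. *)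
Lemma trim_const_uword_schubert_gt0 (w : 'S_n.+1) (a : seq nat) :
  (size a + len w)%N = n -> all (fun c => 0 < c <= n)%N a ->
  0 < lam (uword n a * schubert w).
Proof.
move: {2}(len w) (erefl (len w)) => l.
elim: l w a => [|l IH] w a lw sz an.
  rewrite (len0_perm1 lw) schubert1 mulr1; apply: trim_const_uword_gt0 => //.
  by rewrite -sz lw addn0.
(* The factor [l.+1] is the degree of [schubert w], which [euler] supplies. *)
suff : 0 < lam (uword n a * schubert w) *+ l.+1 by rewrite pmulrn_lgt0.
have hw := schubert_homog w; rewrite lw in hw.
rewrite -(trim_const_euler hw (uword_homog n a)) -?lw //.
have [i ni] : exists i : 'I_n, ~~ ascent w i.
  apply/existsP; rewrite -negb_forall; apply/negP => /forallP aw.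
  by rewrite len_all_ascent in lw.
rewrite /euler mulr_sumr trim_const_sum // (bigD1 i) //=.
have term (k : 'I_n) : lam (uword n a * (u k.+1 * ddiff k (schubert w))) =
    if ascent w k then 0 else lam (uword n (k.+1 :: a) * schubert (mul_s w k)).
  rewrite ddiff_schubert; case: ifP => _; first by rewrite !mulr0 trim_const0.
  by rewrite uword_cons mulrCA mulrA.
have pos (k : 'I_n) : ~~ ascent w k ->
    0 < lam (uword n (k.+1 :: a) * schubert (mul_s w k)).
  move=> nk; have lk : len (mul_s w k) = l by have := len_descent nk; rewrite lw => -[].
  apply: IH => //; first by rewrite lk /=; move: sz; rewrite lw addnS.
  by rewrite /= an andbT ltn_ord.
apply: ltr_pwDl; first by rewrite term (negbTE ni) pos.
apply: sumr_ge0 => k _; rewrite term; case: ifPn => // nk; exact: ltW (pos _ nk).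
Qed.

End Euler.

(** * Extraction of one trimming word from a positive sum *)

Section TrimmingWords.
Variable n : nat.
Local Notation P := {mpoly int[n.+1]}.

Lemma trim_const_word m (f : P) : (m <= n)%N -> f \is m.-homog ->
  0 < trim_const m f ->
  exists s : seq nat, [/\ size s = m,
    (forall j, (j < m)%N -> (1 <= nth 0%N s j <= j.+1)%N) &
    exists c : int, 0 < c /\ foldr (@Top n) f s = c%:MP].
Proof.
elim: m f => [|m IH] f mn hf.
  by exists [::]; split=> //; exists f@_0%MM; split=> //; apply: homog0C.
rewrite trim_constS // => pos.
have [j fj] : exists j : 'I_m.+1, 0 < trim_const m (Top j.+1 f).
  apply/existsP; apply: contraLR pos; rewrite negb_exists -leNgt => /forallP h.
  by apply: sumr_le0 => j _; rewrite leNgt.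
have hT : Top j.+1 f \is m.-homog by apply: Top_homog => //; apply: trim_bound.
have [s [ss sb [c [c0 e]]]] := IH _ (ltnW mn) hT fj.
(* The trimming with the widest range of indices acts first, so it is the last entry of the word. *)
exists (rcons s j.+1); split; first by rewrite size_rcons ss.
  move=> k km; rewrite nth_rcons ss; case: ifP => [|mk]; first exact: sb.
  have -> : k = m by lia.
  by rewrite eqxx; apply: ltn_ord.
by exists c; rewrite foldr_rcons.
Qed.

End TrimmingWords.

(** * Spectator variables and the link between trimmings and divided differences *)

Section Spectators.
Variable n : nat.
Local Notation P := {mpoly int[n.+1]}.

Definition truncate m (f : P) : P :=
  f \mPo [tuple (if (j <= m)%N then 'X_j else 0) | j < n.+1].

HB.instance Definition _ m := GRing.RMorphism.copy (truncate m)
  (comp_mpoly [tuple (if (j <= m)%N then 'X_j else 0 : P) | j < n.+1]).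

Lemma truncateX m (j : 'I_n.+1) : truncate m 'X_j = if (j <= m)%N then 'X_j else 0.
Proof. by rewrite /truncate comp_mpolyXU -tnth_nth tnth_mktuple. Qed.

(** Each monomial containing a spectator variable is killed. The multiplier [g] carries the
    variables already split off. *)
Lemma trim_const_truncate m d f : (m <= n)%N -> (d <= m)%N -> f \is d.-homog ->
  trim_const m (truncate m f) = trim_const m f.
Proof.
move=> mn dm hf; suff H : forall e g, g \is e.-homog -> (e + d <= m)%N ->
    trim_const m (g * truncate m f) = trim_const m (g * f).
  by have := H _ _ (dhomog1 _ _) dm; rewrite !mul1r.
move: d f hf {dm}; apply: (@homog_ind n (fun d f => forall e g, g \is e.-homog ->
    (e + d <= m)%N -> trim_const m (g * truncate m f) = trim_const m (g * f))).
- by move=> d e g _ _; rewrite rmorph0.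
- move=> d f1 f2 h1 h2 e g hg ed; rewrite rmorphD /= !mulrDr !trim_constD //.
  by rewrite (h1 _ _ hg ed) (h2 _ _ hg ed).
- move=> d c f h e g hg ed.
  rewrite [truncate m _]comp_mpolyZ -/(truncate m f) -!scalerAr !scalerAl.
  by apply: h ed; apply: dhomogZ.
- by move=> e g _ _; rewrite rmorph1.
move=> d j f hf IH e g hg ed; rewrite rmorphM /= truncateX; case: leqP => jm.
  rewrite !mulrA; apply: (IH (e + 1)%N); last by lia.
  by apply: dhomogM => //; apply: homogX.
rewrite mul0r mulr0 mulrCA xvarE /trim_const (@trim_iter_xvar0 _ m (e + d)) //.
- by rewrite trim_iter0.
- by lia.
- exact: dhomogM.
- by have := ltn_ord j; lia.
Qed.

(** This is the cycle that sends [i] to [m.+1] and slides the indices between down by one. It agrees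
    with [R_(i+1)], up to spectators, except that 0 is replaced by the variable of index [m.+1]. *)
Definition move_idx m i j : nat :=
  if (j < i)%N then j else if j == i then m.+1 else if (j <= m.+1)%N then j.-1 else j.

Lemma move_idx_le m i (j : 'I_n.+1) : (m < n)%N -> (move_idx m i j < n.+1)%N.
Proof. by move=> mn; rewrite /move_idx; have := ltn_ord j; do ![case: ifP]; lia. Qed.

Definition move_var m i (f : P) : P :=
  f \mPo [tuple 'X_(inord (move_idx m i j)) | j < n.+1].

HB.instance Definition _ m i := GRing.RMorphism.copy (move_var m i)
  (comp_mpoly [tuple ('X_(inord (move_idx m i j)) : P) | j < n.+1]).

Lemma move_varX m i (j : 'I_n.+1) : move_var m i 'X_j = 'X_(inord (move_idx m i j)).
Proof. by rewrite /move_var comp_mpolyXU -tnth_nth tnth_mktuple. Qed.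

Lemma move_var_homog m i d f : f \is d.-homog -> move_var m i f \is d.-homog.
Proof.
by apply: (@homog_rmorph n (move_var m i)) => j; rewrite /= move_varX; apply: homogX.
Qed.

Lemma trim_const_move_var m i d f : (m < n)%N -> (i <= m.+1)%N -> (d <= m)%N ->
  f \is d.-homog -> trim_const m (move_var m i f) = trim_const m (Rop i.+1 f).
Proof.
move=> mn im dm hf; have mn' := ltnW mn.
have hR := Rop_homog (ltn0Sn i) hf; have hM := move_var_homog m i hf.
suff e : truncate m (move_var m i f) = truncate m (Rop i.+1 f).
  by rewrite -(trim_const_truncate mn' dm hM) e (trim_const_truncate mn' dm hR).
move: f {hf hR hM}; apply: (@rmorph_mpoly_ext n _ (truncate m \o move_var m i)
  (truncate m \o Rop i.+1)) => j /=.
rewrite move_varX Rop_X truncateX inordK ?move_idx_le // !ltnS eqSS /move_idx.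
have [ji|ij|e] := ltngtP j i.
- by rewrite -xvarE truncateX inord_val.
- have j0 : (0 < j)%N by apply: leq_ltn_trans ij.
  have ->: xvar n j = 'X_(inord j.-1) by [].
  have jn : (j.-1 < n.+1)%N by have := ltn_ord j; lia.
  rewrite truncateX (inordK jn); case: (leqP j m.+1) => jm //.
  have [-> ->] : (j <= m)%N = false /\ (j.-1 <= m)%N = false by lia.
  by [].
- by rewrite ltnn rmorph0.
Qed.

Lemma Rop_permvars (i : 'I_n) (f : P) :
  Rop i.+1 (permvars (simple i) f) = Rop i.+2 f.
Proof.
apply: (@rmorph_mpoly_ext n _ (Rop i.+1 \o permvars (simple i)) (Rop i.+2)) => j /=.
rewrite permvarsX !Rop_X; case: tpermP => [->|->|/eqP ja /eqP jb] /=.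
- rewrite /bump /= add1n.
  by have [-> -> ->] : [/\ (i.+2 < i.+1)%N = false, (i.+2 == i.+1) = false & (i.+1 < i.+2)%N];
    [split; lia|].
- by rewrite /bump /= add1n !ltnn !eqxx.
have [n1 n2] : (j : nat) <> i /\ (j : nat) <> i.+1.
  by split=> h; [case/eqP: ja|case/eqP: jb]; apply: val_inj; rewrite //= /bump /= add1n.
rewrite !eqSS (introF eqP n1) (introF eqP n2) !ltnS.
by rewrite [(j <= i)%N]leq_eqVlt (introF eqP n1).
Qed.

(** Apply [Rop i.+1] to [alpha i * ddiff i f = f - s_i f]: it sends [alpha i] to [- x_(i+1)] in
    1-based indexing, and [s_i f] to [Rop i.+2 f]. *)
Lemma Top_ddiff (i : 'I_n) (f : P) : Top i.+1 f = Rop i.+1 (ddiff i f).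
Proof.
have ia : (0 < i.+1 <= n)%N by rewrite /= ltn_ord.
apply: (Top_eq ia).
have ra : Rop i.+1 (alpha i) = - xvar n i.+1.
  rewrite alpha_xvar RopB !Rop_xvar ?ltnn ?eqxx ?sub0r ?(ltn_ord i) ?(leqW (ltn_ord i)) //=.
  by rewrite ltnNge leqnSn /= (gtn_eqF (ltnSn _)).
have := congr1 (Rop i.+1) (ddiffE i f); rewrite RopM ra RopB Rop_permvars.
by rewrite mulNr => /(congr1 -%R); rewrite opprK opprB.
Qed.

End Spectators.

(** * Divided symmetrization *)

Section DividedSymmetrization.
Variables (n : nat) (K : fieldType).
Local Notation P := {mpoly int[n.+1]}.
Implicit Types (x y : nat -> K) (f : P).

Definition eval_at x f : K := mmap (intmul 1) (fun j : 'I_n.+1 => x j) f.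

HB.instance Definition _ x :=
  GRing.RMorphism.copy (eval_at x) (mmap (intmul (1 : K)) (fun j : 'I_n.+1 => x j)).

Lemma eval_atX x (j : 'I_n.+1) : eval_at x 'X_j = x j.
Proof. by rewrite /eval_at mmapX mmap1U. Qed.

Lemma eval_at_ext x y : (forall j, (j <= n)%N -> x j = y j) -> eval_at x =1 eval_at y.
Proof.
move=> e; apply: (@rmorph_mpoly_ext n _ (eval_at x) (eval_at y)) => j /=.
by rewrite !eval_atX e // -ltnS.
Qed.

Lemma eval_at_move_var m i x f : (m < n)%N ->
  eval_at x (move_var m i f) = eval_at (x \o move_idx m i) f.
Proof.
move=> mn; apply: (@rmorph_mpoly_ext n _ (eval_at x \o move_var m i)
  (eval_at (x \o move_idx m i))) => j /=.
by rewrite move_varX !eval_atX /= inordK // move_idx_le.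
Qed.

Definition gaps m x : K := \prod_(k < m) (x k - x k.+1).

Definition insert i (t : K) x j : K :=
  if (j < i)%N then x j else if j == i then t else x j.-1.

Lemma gapsS m x : gaps m.+1 x = gaps m x * (x m - x m.+1).
Proof. exact: big_ord_recr. Qed.

Lemma gaps_ext m x y : (forall j, (j <= m)%N -> x j = y j) -> gaps m x = gaps m y.
Proof. by move=> e; apply: eq_bigr => -[k km] _ /=; rewrite !e // ltnW. Qed.

Lemma gaps_insert_last m t x : gaps m.+1 (insert m.+1 t x) = gaps m x * (x m - t).
Proof.
rewrite gapsS (gaps_ext (y := x)); last by move=> j jm; rewrite /insert ltnS jm.
by rewrite /insert ltnSn ltnn eqxx.
Qed.

Lemma gaps_insert_first m t x : gaps m.+1 (insert 0 t x) = (t - x 0%N) * gaps m x.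
Proof. by rewrite /gaps big_ord_recl; congr (_ * _). Qed.

Lemma gaps_insert m i t x : (i < m)%N ->
  gaps m.+1 (insert i.+1 t x) * (x i - x i.+1) = gaps m x * (x i - t) * (t - x i.+1).
Proof.
elim: m => // m IH; rewrite ltnS leq_eqVlt => /orP[/eqP->|im].
  rewrite gapsS gaps_insert_last gapsS.
  have -> : insert m.+1 t x m.+1 = t by rewrite /insert ltnn eqxx.
  have -> : insert m.+1 t x m.+2 = x m.+1 by rewrite /insert ltnNge leqnSn /= (gtn_eqF (ltnSn _)).
  by move: (gaps m x) (x m) (x m.+1) => *; ring.
rewrite gapsS mulrAC IH // [in RHS]gapsS.
have -> : insert i.+1 t x m.+1 = x m.
  by have [a b] : (m.+1 < i.+1)%N = false /\ (m.+1 == i.+1) = false; [lia|rewrite /insert a b].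
have -> : insert i.+1 t x m.+2 = x m.+1.
  by have [a b] : (m.+2 < i.+1)%N = false /\ (m.+2 == i.+1) = false; [lia|rewrite /insert a b].
by move: (gaps m x) (x i) (x i.+1) (x m) (x m.+1) => *; ring.
Qed.

(** The value 0 outside the range lets one partial fraction formula cover insertion at either
    end. *)
Definition pole m x k : K := if (0 < k <= m.+1)%N then (x k.-1 - x m.+1)^-1 else 0.

Definition distinct m x := forall i j, (i < j <= m)%N -> x i - x j != 0.

Lemma gaps_neq0 m x : distinct m x -> gaps m x != 0.
Proof. by move=> dx; apply/prodf_neq0 => -[k km] _ /=; apply: dx; rewrite ltnSn. Qed.

(** Inserting [t] between neighbours [p] and [q] multiplies the inverse product by
    [(p - q) / ((p - t) (t - q))], which is [1 / (p - t) - 1 / (q - t)]. *)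
Lemma gaps_move_idx m i x : (i <= m.+1)%N -> distinct m.+1 x ->
  (gaps m.+1 (x \o move_idx m i))^-1 = (gaps m x)^-1 * (pole m x i - pole m x i.+1).
Proof.
move=> im dx; set t := x m.+1.
rewrite (gaps_ext (y := insert i t x)); last first.
  by move=> j jm; rewrite /insert /= /move_idx jm; case: ltngtP.
have g0 : gaps m x != 0.
  by apply: gaps_neq0 => k l /andP[kl lm]; apply: dx; rewrite kl leqW.
have xt k : (k <= m)%N -> x k - t != 0 by move=> km; apply: dx; rewrite ltnS km leqnn.
case: i im => [|i] im.
  rewrite gaps_insert_first invfM mulrC /pole /= sub0r -invrN opprB.
  by [].
rewrite /pole /= -/t im /=; move: im; rewrite ltnS leq_eqVlt => /orP[/eqP->|im].
  by rewrite gaps_insert_last ltnn subr0 invfM.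
have := gaps_insert t x im; rewrite ltnS im.
have xi : x i - x i.+1 != 0 by apply: dx; rewrite ltnSn leqW.
have a := xt _ (ltnW im); have b := xt _ im.
have b' : t - x i.+1 != 0 by rewrite -opprB oppr_eq0.
move=> e; have -> : gaps m.+1 (insert i.+1 t x) =
    gaps m x * (x i - t) * (t - x i.+1) / (x i - x i.+1) by rewrite -e mulfK.
move: (gaps m x) (x i) (x i.+1) t g0 xi a b b' {e dx xt} => g p q t g0 pq pt qt tq.
by field; rewrite g0 pq pt qt tq.
Qed.

(* Summation by parts over the position of the last variable turns the poles
   into divided differences, hence into a polynomial. *)
Lemma sum_move_idx m x f (mn : (m < n)%N) : distinct m.+1 x ->
  \sum_(i < m.+2) eval_at (x \o move_idx m i) f / gaps m.+1 (x \o move_idx m i) =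
  eval_at x (\sum_(i < m.+1) move_var m i.+1 (ddiff (widen_ord mn i) f)) / gaps m x.
Proof.
move=> dx; set t := x m.+1.
pose F i := eval_at (x \o move_idx m i) f; pose b := pole m x.
rewrite (eq_bigr (fun i : 'I_m.+2 => (F i * b i - F i * b i.+1) / gaps m x)); last first.
  by move=> [i im] _; rewrite gaps_move_idx // -mulrBr -[RHS]mulrA; congr (_ * _); rewrite mulrC.
rewrite -mulr_suml; congr (_ / _).
rewrite sumrB big_ord_recl [X in _ - X]big_ord_recr /=.
have -> : b 0%N = 0 by [].
have -> : b m.+2 = 0 by rewrite /b /pole ltnn.
rewrite !mulr0 add0r addr0 -sumrB rmorph_sum; apply: eq_bigr => -[i im] _ /=.
rewrite /bump /= add1n -mulrBl.
set p := widen_ord mn _; have pi : p = i :> nat by [].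
rewrite eval_at_move_var //.
set z := x \o move_idx m i.+1.
have zi : z i = x i by rewrite /z /= /move_idx ltnSn.
have zi1 : z i.+1 = t by rewrite /z /= /move_idx ltnn eqxx.
have xit : x i - t != 0 by apply: dx; rewrite im leqnn.
have -> : b i.+1 = (x i - t)^-1 by rewrite /b /pole im.
(* Putting the last variable in slot [i] rather than [i.+1] amounts to swapping these two slots, so
   [F i.+1 - F i] is the numerator of a divided difference. *)
have swap : F i = eval_at z (permvars (simple p) f).
  apply: (@rmorph_mpoly_ext n _ (eval_at (x \o move_idx m i))
    (eval_at z \o permvars (simple p))) => j /=.
  rewrite permvarsX !eval_atX; case: tpermP => [->|->|/eqP ja /eqP jb].
  - by rewrite /= /bump /= add1n zi1 /move_idx ltnn eqxx.
  - rewrite /= /bump /= add1n zi /move_idx ltnNge leqnSn /= (gtn_eqF (ltnSn _)).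
    by rewrite im.
  have [n1 n2] : (j : nat) <> i /\ (j : nat) <> i.+1.
    by split=> h; [case/eqP: ja|case/eqP: jb]; apply: val_inj; rewrite //= /bump /= add1n.
  rewrite /z /= /move_idx (introF eqP n1) (introF eqP n2) ltnS.
  by rewrite [(j <= i)%N]leq_eqVlt (introF eqP n1).
have za : eval_at z (alpha p) = x i - t.
  by rewrite /alpha rmorphB /= !eval_atX /= /bump /= add1n zi zi1.
have e : eval_at z (alpha p) * eval_at z (ddiff p f) = F i.+1 - F i.
  by rewrite swap -rmorphM ddiffE rmorphB.
by rewrite -e za mulrC mulKf.
Qed.

(** Extending by the identity lets permutations of all sizes act on the same sequences. *)
Definition act_idx m (s : 'S_m.+1) j : nat :=
  if insub j is Some i then s i else j.

Lemma act_idx_ord m (s : 'S_m.+1) (i : 'I_m.+1) : act_idx s i = s i.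
Proof. by rewrite /act_idx valK. Qed.

Lemma act_idx_gt m (s : 'S_m.+1) j : (m < j)%N -> act_idx s j = j.
Proof. by move=> mj; rewrite /act_idx insubF // ltnNge mj. Qed.

Lemma act_idx_le m m' (s : 'S_m.+1) j : (m <= m')%N -> (j <= m')%N ->
  (act_idx s j <= m')%N.
Proof.
move=> mm jm; case: (ltnP m j) => mj; first by rewrite act_idx_gt.
have -> : j = (Ordinal (mj : (j < m.+1)%N)) by [].
by rewrite act_idx_ord; apply: leq_trans mm; rewrite -ltnS.
Qed.

Lemma act_idx_inj m (s : 'S_m.+1) : injective (act_idx s).
Proof.
move=> i j; case: (ltnP m i) => mi; case: (ltnP m j) => mj.
- by rewrite !act_idx_gt.
- by have := act_idx_le s (leqnn m) mj; rewrite (act_idx_gt s mi); lia.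
- by have := act_idx_le s (leqnn m) mi; rewrite (act_idx_gt s mj); lia.
rewrite (act_idx_ord s (Ordinal (mi : (i < m.+1)%N))).
rewrite (act_idx_ord s (Ordinal (mj : (j < m.+1)%N))).
by move=> /val_inj/perm_inj/(congr1 val).
Qed.

Lemma distinct_act_idx m m' (s : 'S_m.+1) x : (m <= m')%N ->
  distinct m' x -> distinct m' (x \o act_idx s).
Proof.
move=> mm dx i j /andP[ij jm] /=.
have [ai aj] := (act_idx_le s mm (leq_trans (ltnW ij) jm), act_idx_le s mm jm).
have [lt|gt|/act_idx_inj e] := ltngtP (act_idx s i) (act_idx s j).
- by apply: dx; rewrite lt.
- by rewrite -opprB oppr_eq0; apply: dx; rewrite gt.
- by rewrite e ltnn in ij.
Qed.

Lemma act_idx_lift_perm m (i : 'I_m.+2) (s : 'S_m.+1) j :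
  act_idx (lift_perm i ord_max s) j = act_idx s (move_idx m i j).
Proof.
case: (ltnP m.+1 j) => jm.
  have [a b c] : [/\ (j < i)%N = false, (j == i) = false & (j <= m.+1)%N = false].
    by have := ltn_ord i; split; lia.
  by rewrite !act_idx_gt // /move_idx a b c // ltnW.
have [{jm} j' ->] : exists j' : 'I_m.+2, j = j' by exists (Ordinal (jm : (j < m.+2)%N)).
rewrite act_idx_ord; case: (unliftP i j') => [k|] ->; last first.
  by rewrite lift_perm_id /move_idx ltnn eqxx act_idx_gt.
rewrite lift_perm_lift lift_max -act_idx_ord; congr (act_idx s _).
rewrite /move_idx /= /bump; have := ltn_ord k; case: (leqP i k) => ik /= km; rewrite ?add0n ?add1n.
  by rewrite ltnNge (leqW ik) /= (gtn_eqF (ik : (i < k.+1)%N)) km.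
by rewrite ik.
Qed.

(** A permutation is determined by the slot [i] of the largest value and the permutation left after
    removing it; injectivity and a count give the bijection. *)
Lemma sum_lift_perm m (G : 'S_m.+2 -> K) :
  \sum_s G s = \sum_(s : 'S_m.+1) \sum_(i : 'I_m.+2) G (lift_perm i ord_max s).
Proof.
pose h (p : 'S_m.+1 * 'I_m.+2) := lift_perm p.2 ord_max p.1.
have h_inj : injective h.
  move=> [s i] [t j]; rewrite /h /= => e.
  have ij : i = j.
    apply: (@perm_inj _ (lift_perm j ord_max t)).
    by rewrite lift_perm_id -e lift_perm_id.
  subst j; congr (_, _); apply/permP => k.
  by apply: (@lift_inj _ ord_max); rewrite -!(lift_perm_lift i) e.
have h_bij : bijective h.
  apply: inj_card_bij h_inj _.
  by rewrite card_prod !card_Sn card_ord mulnC -factS.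
rewrite (reindex h) /=; last exact: onW_bij.
by rewrite pair_bigA.
Qed.

Definition sym_sum m x f : K :=
  \sum_(s : 'S_m.+1) eval_at (x \o act_idx s) f / gaps m (x \o act_idx s).

Lemma sym_sumS m x f (mn : (m < n)%N) : distinct m.+1 x ->
  sym_sum m.+1 x f =
  sym_sum m x (\sum_(i < m.+1) move_var m i.+1 (ddiff (widen_ord mn i) f)).
Proof.
move=> dx; rewrite /sym_sum sum_lift_perm; apply: eq_bigr => s _.
rewrite -(sum_move_idx f mn (distinct_act_idx s (leqnSn m) dx)).
apply: eq_bigr => i _; congr (_ / _).
  by apply: eval_at_ext => j _; rewrite /= act_idx_lift_perm.
by apply: gaps_ext => j _; rewrite /= act_idx_lift_perm.
Qed.

Lemma sym_sum_trim_const m d x f : (m <= n)%N -> (d <= m)%N -> f \is d.-homog ->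
  distinct m x -> sym_sum m x f = (trim_const m f)%:~R.
Proof.
elim: m d x f => [|m IH] d x f mn dm hf dx.
  have {dm} d0 : d = 0%N by lia.
  rewrite d0 in hf; rewrite /sym_sum (big_pred1 1%g) => [|s]; last first.
    by apply/esym/eqP/permP => i; rewrite !ord1.
  rewrite /gaps big_ord0 divr1 /trim_const /= {1}(homog0C hf).
  exact: mmapC.
rewrite (sym_sumS _ mn dx).
have mn' := ltnW mn.
have dx' : distinct m x by move=> i j /andP[ij jm]; apply: dx; rewrite ij leqW.
case: d dm hf => [|d] dm hf.
  rewrite (homog0C hf) big1 => [|i _]; last first.
    by rewrite ddiffC; exact: (rmorph0 (move_var m i.+1)).
  rewrite /trim_const /= trim_sumC // trim_iter0 // mcoeff0 /sym_sum big1 // => s _.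
  by rewrite (rmorph0 (eval_at _)) mul0r.
have hd (i : 'I_m.+1) : ddiff (widen_ord mn i) f \is d.-homog by apply: ddiff_homog.
rewrite (IH d) //; last by apply: rpred_sum => i _; apply: move_var_homog.
congr (_%:~R); rewrite trim_constS // trim_const_sum //; apply: eq_bigr => i _.
(* This yields [Rop i.+2] of the divided difference. Its invariance under [s_i] turns that into
   [Rop i.+1], hence into a trimming. *)
rewrite (@trim_const_move_var _ m i.+1 d) ?ltn_ord //.
congr (trim_const m _); rewrite -[Top _ _]/(Top (widen_ord mn i).+1 f) Top_ddiff.
by rewrite -{2}(permvars_ddiff (widen_ord mn i) f) Rop_permvars.
Qed.

End DividedSymmetrization.

(** Take the field of fractions for [K] and evaluate at the variables themselves, which are
    distinct. *)
Lemma divsym_trim_const (n : nat) (f : {mpoly int[n.+1]}) : f \is n.-homog ->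
  divsym f = ((trim_const n f)%:MP : {mpoly int[n.+1]})%:F.
Proof.
move=> hf; pose x (j : nat) : {fraction {mpoly int[n.+1]}} := ('X_(inord j))%:F.
have dx : distinct n x.
  move=> i j /andP[ij jn]; rewrite -rmorphB tofrac_eq0 subr_eq0.
  apply/eqP => /mpolyXI /(congr1 val) /=; rewrite !inordK //.
    by move=> e; rewrite e ltnn in ij.
  exact: leq_trans ij (leqW jn).
have -> : ((trim_const n f)%:MP : {mpoly int[n.+1]})%:F = (trim_const n f)%:~R.
  by rewrite -[trim_const n f in LHS]intz rmorph_int rmorph_int.
rewrite -(sym_sum_trim_const (leqnn n) (leqnn n) hf dx).
apply: eq_bigr => s _; congr (_ / _).
  apply: (@rmorph_mpoly_ext n _ (@FracField.tofrac _ \o permvars s)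
    (eval_at (x \o act_idx s))) => j /=.
  by rewrite permvarsX eval_atX /= act_idx_ord /x inord_val.
rewrite rmorph_prod; apply: eq_bigr => k _; rewrite rmorphB /=.
have e1 : (k : nat) = sfirst k by [].
have e2 : k.+1 = ssecond k by [].
by rewrite e1 e2 !act_idx_ord /x !inord_val.
Qed.

(* w in S_{n+1} with l(w) = (n+1) - 1 = n. *)
Theorem mainTheorem19 (n : nat) (w : 'S_n.+1) :
  len w = n ->
  (exists s : seq nat,
      [/\ size s = n,
          (forall j : nat, (j < n)%N -> (1 <= nth 0%N s j <= j.+1)%N) &
          exists c : int, 0 < c /\
            foldr (@Top n) (schubert w) s = c%:MP]) /\
  (exists c : int, 0 < c /\ divsym (schubert w) = (c%:MP : {mpoly int[n.+1]})%:F).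
Proof.
move=> lw.
have hw : schubert w \is n.-homog by rewrite -[X in X.-homog]lw; apply: schubert_homog.
have pos : 0 < trim_const n (schubert w).
  rewrite -[schubert w]mul1r -(uword_nil n).
  by apply: trim_const_uword_schubert_gt0; rewrite ?lw.
split; first exact: trim_const_word.
by exists (trim_const n (schubert w)); rewrite divsym_trim_const.
Qed.
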